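(* Let $\mathbf{d}$ be a linear continuous dilation in $\mathbb{R}^n$ monotone with respect to a norm $\|\cdot\|_{\mathbb{R}^n}$, and $\tilde{\mathbf{d}}$ a linear continuous dilation in $\mathbb{R}^k$ monotone with respect to a norm $\|\cdot\|_{\mathbb{R}^k}$. Let $f\in C(\mathbb{R}^n\times\mathbb{R}^k,\mathbb{R}^n)$ satisfy, for some $\mu>-1$, $$f(\mathbf{d}(s)x,\tilde{\mathbf{d}}(s)q)=e^{\mu s}\mathbf{d}(s)f(x,q)\quad\forall s\in\mathbb{R},\ x\in\mathbb{R}^n,\ q\in\mathbb{R}^k.$$ Let $\Omega=\{x\in\mathbb{R}^n:\phi_i(x)\ge0,\ i=1,\dots,p\}$ have non-empty interior, where each $\phi_i\in C(\mathbb{R}^n,\mathbb{R})\cap C^1(\mathbb{R}^n\setminus\{0\},\mathbb{R})$ is $\mathbf{d}$-homogeneous of degree $\nu_i>0$. Consider the system $$\dot x=f(x,q),\quad t>t_0,\quad x(t_0)=x_0,$$ and assume that it is forward complete for any $q\in L^\infty(\mathbb{R},\mathbb{R}^k)$, and that for any $q\in L^\infty(\mathbb{R},\mathbb{R}^k)$ and any $x_0\in\mathbb{R}^n\setminus\mathrm{int}\,\Omega$ the solution is forward unique (at least locally in time). For $r=(r_1,\dots,r_p)^\top\in\mathbb{R}^p_+$ let $$\Omega_r=\{x\in\mathbb{R}^n:\phi_i(x)+r_i^{\nu_i}\ge0,\ i=1,\dots,p\}.$$ If there exists $r\in\mathbb{R}^p_+$ such that $$f(x,q)\in\mathcal{C}_{\Omega_r}(x),\quad\forall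 x\in\partial\Omega_r,\quad\forall q\in\mathbb{R}^k:\|q\|_{\mathbb{R}^k}\le1,$$ then the system is ISSf on $\Omega$.
   Context: $\mathbb{R}_+=[0,+\infty)$. A linear continuous dilation in $\mathbb{R}^n$ is a family $\mathbf{d}(s)=e^{sG_{\mathbf{d}}}$, $s\in\mathbb{R}$, $G_{\mathbf{d}}\in\mathbb{R}^{n\times n}$, such that $\liminf_{s\to+\infty}\|\mathbf{d}(s)x\|=+\infty$ and $\limsup_{s\to-\infty}\|\mathbf{d}(s)x\|=0$ for all $x\ne 0$ (similarly for $\tilde{\mathbf{d}}$ in $\mathbb{R}^k$). It is monotone with respect to a norm if $s\mapsto\|\mathbf{d}(s)x\|$ is strictly increasing for each $x\neq 0$. A function $h:\mathbb{R}^n\to\mathbb{R}$ is $\mathbf{d}$-homogeneous of degree $\nu$ if $h(\mathbf{d}(s)x)=e^{\nu s}h(x)$ for all $x\in\mathbb{R}^n,s\in\mathbb{R}$. For a closed set $\Xi$, the (Bouligand) tangent cone at $x\in\Xi$ is $\mathcal{C}_\Xi(x)=\{z\in\mathbb{R}^n:\liminf_{h\to0^+}\frac{1}{h}\inf_{y\in\Xi}\|x+hz-y\|=0\}$. Forward complete: all solutions are defined for all $t\ge t_0$. $|\cdot|$ is the Euclidean norm; $\|q\|_{L^\infty_{(t_0,t)}}=\mathrm{ess\,sup}_{\tau\in(t_0,t)}|q(\tau)|$. $\mathcal{K}$ is the class of continuous strictly increasing $\sigma:[0,\infty)\to[0,\infty)$ with $\sigma(0)=0$. The system is Input-to-State Safe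 (ISSf) on $\Omega$ if there exist $\gamma_i\in\mathcal{K}$ such that $-\gamma_i(\|q\|_{L^\infty_{(t_0,t)}})\le\phi_i(x(t))$ for all $t\ge t_0$, $x_0\in\Omega$, $q\in L^\infty(\mathbb{R},\mathbb{R}^k)$ and $i=1,\dots,p$. *)

(* Defs.v *)
From mathcomp Require Import all_boot all_order all_algebra.
From mathcomp Require Import all_classical all_reals all_analysis.

Set Implicit Arguments.
Unset Strict Implicit.
Unset Printing Implicit Defensive.

Import Order.TTheory GRing.Theory Num.Theory.
Import numFieldNormedType.Exports.

Local Open Scope classical_set_scope.
Local Open Scope ring_scope.

Section Defs.
Context {R : realType}.

Definition expmx n (A : 'M[R]_n) : 'M[R]_n :=
  limn (series (fun j => (j`!%:R)^-1 *: A ^+ j)).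

(* An arbitrary norm on R^n, not the sup norm that the library puts on
   ['cV[R]_n]; both induce the library's topology. *)
Definition is_norm n (N : 'cV[R]_n -> R) : Prop :=
  [/\ forall x y, N (x + y) <= N x + N y,
      forall (a : R) x, N (a *: x) = `|a| * N x &
      forall x, N x = 0 -> x = 0].

Definition eucl n (x : 'cV[R]_n) : R := Num.sqrt (\sum_i x i 0 ^+ 2).

Definition dilation n (G : 'M[R]_n) (s : R) (x : 'cV[R]_n) : 'cV[R]_n :=
  expmx (s *: G) *m x.

Definition is_dilation n (N : 'cV[R]_n -> R) (G : 'M[R]_n) : Prop :=
  forall x, x != 0 ->
    limf_einf (fun s => (N (dilation G s x))%:E) (pinfty_nbhs R) = +oo%E /\
    limf_esup (fun s => (N (dilation G s x))%:E) (ninfty_nbhs R) = 0%E.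

Definition monotone_dilation n (N : 'cV[R]_n -> R) (G : 'M[R]_n) : Prop :=
  forall x, x != 0 -> {homo (fun s => N (dilation G s x)) : s t / s < t}.

Definition homogeneous n (G : 'M[R]_n) (nu : R) (h : 'cV[R]_n -> R) : Prop :=
  forall x s, h (dilation G s x) = expR (nu * s) * h x.

Definition C1_off_origin n (h : 'cV[R]_n -> R) : Prop :=
  forall x : 'cV[R]_n, x != 0 ->
    differentiable h x /\
    forall v, {for x, continuous (fun y => 'D_v h y)}.

Definition boundary n (A : set 'cV[R]_n) : set 'cV[R]_n :=
  closure A `\` interior A.

Definition tangent_cone n (N : 'cV[R]_n -> R) (Xi : set 'cV[R]_n)
    (x : 'cV[R]_n) : set 'cV[R]_n :=
  [set z | limf_einf
     (fun h : R => (h^-1 * inf [set N (x + h *: z - y) | y in Xi])%:E)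
     (0 : R)^'+ = 0%E].

Definition safe_set n p (phi : 'I_p -> 'cV[R]_n -> R) : set 'cV[R]_n :=
  [set x | forall i, 0 <= phi i x].

Definition enlarged_safe_set n p (phi : 'I_p -> 'cV[R]_n -> R)
    (nu r : 'I_p -> R) : set 'cV[R]_n :=
  [set x | forall i, 0 <= phi i x + r i `^ nu i].

Definition Linfty k (q : R -> 'cV[R]_k) : Prop :=
  (forall j, measurable_fun setT (fun t => q t j 0)) /\
  finite_norm lebesgue_measure +oo%E (fun t => eucl (q t)).

(* The norm of q in L^oo on ]t0, t[, as the norm on the line of q extended by
   zero; it is 0 when t = t0. *)
Definition Linfty_norm k (q : R -> 'cV[R]_k) (t0 t : R) : R :=
  fine (Lnorm lebesgue_measure +oo%E
          ((fun tau => (eucl (q tau))%:E) \_ `]t0, t[)).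

(* sigma is only constrained on [0, +oo[. *)
Definition class_K (sigma : R -> R) : Prop :=
  [/\ {within `[0, +oo[%classic, continuous sigma},
      {in `[0, +oo[ &, {homo sigma : a b / a < b}} &
      sigma 0 = 0].

Definition absolutely_continuous n (a b : R) (x : R -> 'cV[R]_n) : Prop :=
  forall e : R, 0 < e -> exists2 delta : R, 0 < delta &
    forall m (u v : 'I_m -> R),
      (forall i, a <= u i /\ u i <= v i /\ v i <= b) ->
      trivIset setT (fun i => `]u i, v i[%classic) ->
      \sum_i (v i - u i) < delta ->
      \sum_i `|x (v i) - x (u i)| < e.

(* Caratheodory solution of x' = f(x, q), x(t0) = x0 on [t0, T[, T possibly
   infinite; the values of x outside [t0, T[ are irrelevant. *)
Definition is_solution n k (f : 'cV[R]_n -> 'cV[R]_k -> 'cV[R]_n)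
    (q : R -> 'cV[R]_k) (t0 : R) (x0 : 'cV[R]_n) (T : \bar R)
    (x : R -> 'cV[R]_n) : Prop :=
  [/\ (t0%:E < T)%E, x t0 = x0,
      forall b, t0 <= b -> (b%:E < T)%E -> absolutely_continuous t0 b x &
      {ae lebesgue_measure, forall t : R, t0 < t -> (t%:E < T)%E ->
         is_derive t 1 x (f (x t) (q t))}].

Definition is_maximal_solution n k (f : 'cV[R]_n -> 'cV[R]_k -> 'cV[R]_n)
    (q : R -> 'cV[R]_k) (t0 : R) (x0 : 'cV[R]_n) (T : \bar R)
    (x : R -> 'cV[R]_n) : Prop :=
  is_solution f q t0 x0 T x /\
  forall T' y, (T <= T')%E -> is_solution f q t0 x0 T' y ->
    (forall t, t0 <= t -> (t%:E < T)%E -> y t = x t) -> T' = T.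

Definition forward_complete n k (f : 'cV[R]_n -> 'cV[R]_k -> 'cV[R]_n)
    (q : R -> 'cV[R]_k) (t0 : R) : Prop :=
  forall x0 T x, is_maximal_solution f q t0 x0 T x -> T = +oo%E.

Definition locally_forward_unique n k
    (f : 'cV[R]_n -> 'cV[R]_k -> 'cV[R]_n) (q : R -> 'cV[R]_k) (t0 : R)
    (x0 : 'cV[R]_n) : Prop :=
  forall T x T' y, is_solution f q t0 x0 T x -> is_solution f q t0 x0 T' y ->
    \forall t \near t0^'+, x t = y t.

Definition ISSf n k p (f : 'cV[R]_n -> 'cV[R]_k -> 'cV[R]_n) (t0 : R)
    (phi : 'I_p -> 'cV[R]_n -> R) : Prop :=
  exists2 gamma : 'I_p -> R -> R, forall i, class_K (gamma i) &
    forall x0 q x, safe_set phi x0 -> Linfty q ->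
      is_solution f q t0 x0 +oo%E x ->
      forall t i, t0 <= t -> - gamma i (Linfty_norm q t0 t) <= phi i (x t).

End Defs.

(* Main.v *)
Require Import Defs.
From mathcomp Require Import all_boot all_order all_algebra.
From mathcomp Require Import all_classical all_reals all_analysis.
From mathcomp Require Import measurable_realfun ess_sup_inf ring lra.

Set Implicit Arguments.
Unset Strict Implicit.
Unset Printing Implicit Defensive.

Import Order.TTheory GRing.Theory Num.Theory.
Import numFieldNormedType.Exports.

Local Open Scope classical_set_scope.
Local Open Scope ring_scope.

(** The set [Omega_r] is cut out by homogeneous functions, so the dilation
    [d(s)] carries it onto [K_s], the set where [phi_i >= -(e^s r_i)^nu_i] for
    every [i]. The homogeneity of [f] carries the tangency hypothesis along:
    [f x v] is tangent to [K_s] at each of its points as soon as [v] lies in the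
    image [Q_s] of the unit ball under the dilation of the input space
    ([scaled_set_bouligand]). Every [K_s] contains the safe set. If therefore
    every [K_s] is forward invariant for inputs with values in [Q_s], then an
    input of essential bound [c] lets [phi_i] drop at most to
    [-(e^s r_i)^nu_i], for every [s] such that [Q_s] contains the ball of
    radius [c]. The infimum of these numbers over [s] is a nondecreasing
    function of [c] that tends to [0] with [c], because each [Q_s] is a
    neighbourhood of the origin, and such a function lies below one of
    class K ([majorant_class_K]). That some [Q_s] contains a given ball is a
    Dini argument on the unit sphere ([dilation_unbounded]). Each
    [d(s)] is invertible because monotonicity makes it injective.

    Forward invariance ([forward_invariant]) is a Nagumo theorem for inputs that
    are only measurable in time. A solution that is about to leave [K] sits on
    its boundary, outside the interior of the safe set, hence is locally unique
    there, and it suffices to exhibit one solution that remains in [K] for a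
    short while ([local_viable_solution]).

    That solution is a limit of Euler polygons in which the field is evaluated
    at the point of [K] nearest to the current node. The Bouligand cone need not
    be convex, so tangency does not survive the averaging of the field over a
    time step. It implies however that [<x - p, f p v> <= 0] whenever [p] is a
    point of [K] nearest to [x] ([bouligand_nearest]), and this inequality is
    linear in [f p v]: it can be integrated over the step. Hence a step of
    length [h] increases the squared distance to [K] by [O(h^2)] only, and over
    a unit of time this distance remains [O(sqrt h)] ([euler_node_dist]). A
    subsequence of the polygons converges ([equilipschitz_subsequence]), and
    dominated convergence identifies its limit as a Caratheodory solution in [K]
    ([viable_solution]). *)

(** * Linear algebra and norms on column vectors *)

Section EuclideanSpace.
Context {R : realType}.

Lemma coord_le_norm m n (x : 'M[R]_(m, n)) i j : `|x i j| <= `|x|.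
Proof. by rewrite [leRHS]/Num.norm/= mx_normrE; exact: (le_bigmax _ _ (i, j)). Qed.

Lemma norm_le_coord m n (x : 'M[R]_(m, n)) M :
  0 <= M -> (forall i j, `|x i j| <= M) -> `|x| <= M.
Proof.
by move=> M0 xM; rewrite [leLHS]/Num.norm/= mx_normrE bigmax_le//= => -[i j] _.
Qed.

Lemma lipschitz_continuous (V W : normedModType R) (f : V -> W) (C : R) :
  (forall x y, `|f x - f y| <= C * `|x - y|) -> continuous f.
Proof.
move=> fC x; apply/cvgrPdist_le => e e0.
have C0 : 0 < `|C| + 1 by rewrite ltr_wpDl.
near=> y; rewrite (le_trans (fC _ _))//.
apply: (@le_trans _ _ ((`|C| + 1) * `|x - y|)).
  by rewrite ler_wpM2r// (le_trans (ler_norm _))// lerDl.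
rewrite mulrC -ler_pdivlMr//; near: y; apply: cvgr_dist_le => //.
exact: divr_gt0.
Unshelve. all: by end_near. Qed.

Lemma trmx_continuous m n : continuous (@trmx R m n).
Proof.
apply: (@lipschitz_continuous _ _ _ 1) => x y; rewrite mul1r -linearB/=.
by apply: norm_le_coord => // i j; rewrite mxE coord_le_norm.
Qed.

Lemma closed_bounded_compact n (A : set 'cV[R]_n) (M : R) :
  closed A -> (forall x, A x -> `|x| <= M) -> compact A.
Proof.
move=> clA bA.
have -> : A = trmx @` ((@trmx R 1 n) @^-1` A).
  apply/seteqP; split=> [x Ax|_ [y Ay <-]//].
  by exists x^T; rewrite /preimage/= trmxK.
apply: continuous_compact.
  by apply: continuous_subspaceT => x; exact: trmx_continuous.
apply: bounded_closed_compact.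
  exists M; split; first exact: num_real.
  move=> M' MM' y /= /bA yM; apply: (le_trans _ (le_trans yM (ltW MM'))).
  apply: norm_le_coord => // i j.
  by rewrite -(mxE trmx_key (fun a b => y b a)) coord_le_norm.
by apply: closed_comp => // x _; exact: trmx_continuous.
Qed.

Lemma normM_mulmx m n (A : 'M[R]_(m, n)) (x : 'cV[R]_n) :
  `|A *m x| <= n%:R * `|A| * `|x|.
Proof.
apply: norm_le_coord => [|i j]; first by rewrite !mulr_ge0.
rewrite mxE (le_trans (ler_norm_sum _ _ _))//.
apply: (@le_trans _ _ (\sum_(k < n) `|A| * `|x|)).
  by apply: ler_sum => k _; rewrite normrM ler_pM// coord_le_norm.
by rewrite sumr_const card_ord -[leLHS]mulr_natl mulrA.
Qed.

Lemma mulmx_continuous m n (A : 'M[R]_(m, n)) :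
  continuous (fun x : 'cV[R]_n => A *m x).
Proof.
apply: (@lipschitz_continuous _ _ _ (n%:R * `|A|)) => x y.
by rewrite -mulmxBr normM_mulmx.
Qed.

(** The row kernel of the transpose consists of the transposed vectors that [A]
    kills. *)
Lemma mulmx_inj_unit n (A : 'M[R]_n) :
  (forall x : 'cV[R]_n, A *m x = 0 -> x = 0) -> A \in unitmx.
Proof.
move=> A0; rewrite -unitmx_tr -row_free_unit -kermx_eq0; apply/eqP/row_matrixP => i.
rewrite row0 -[row _ _]trmxK (A0 (row i (kermx A^T))^T) ?trmx0//.
apply: trmx_inj; rewrite trmx_mul trmxK trmx0.
by rewrite -row_mul mulmx_ker row0.
Qed.

Definition dotp n (x y : 'cV[R]_n) : R := \sum_i x i 0 * y i 0.

Lemma dotpC n (x y : 'cV[R]_n) : dotp x y = dotp y x.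
Proof. by apply: eq_bigr => i _; rewrite mulrC. Qed.

Lemma dotpDl n (x y z : 'cV[R]_n) : dotp (x + y) z = dotp x z + dotp y z.
Proof. by rewrite -big_split; apply: eq_bigr => i _; rewrite mxE mulrDl. Qed.

Lemma dotpZl n a (x y : 'cV[R]_n) : dotp (a *: x) y = a * dotp x y.
Proof. by rewrite mulr_sumr; apply: eq_bigr => i _; rewrite mxE mulrA. Qed.

Lemma dotpDr n (x y z : 'cV[R]_n) : dotp x (y + z) = dotp x y + dotp x z.
Proof. by rewrite dotpC dotpDl !(dotpC x). Qed.

Lemma dotpZr n a (x y : 'cV[R]_n) : dotp x (a *: y) = a * dotp x y.
Proof. by rewrite dotpC dotpZl (dotpC x). Qed.

Lemma dotp_ge0 n (x : 'cV[R]_n) : 0 <= dotp x x.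
Proof. by apply: sumr_ge0 => i _; rewrite -expr2 sqr_ge0. Qed.

Lemma dotp_le n (x y : 'cV[R]_n) : `|dotp x y| <= n%:R * (`|x| * `|y|).
Proof.
rewrite (le_trans (ler_norm_sum _ _ _))//.
apply: (@le_trans _ _ (\sum_(k < n) `|x| * `|y|)).
  by apply: ler_sum => k _; rewrite normrM ler_pM// coord_le_norm.
by rewrite sumr_const card_ord mulr_natl.
Qed.

Lemma norm_le_dotp n (x : 'cV[R]_n) : `|x| ^+ 2 <= dotp x x.
Proof.
rewrite -[leRHS](sqr_sqrtr (dotp_ge0 x)) lerXn2r ?nnegrE ?sqrtr_ge0//.
apply: norm_le_coord => [|i j]; first exact: sqrtr_ge0.
rewrite -sqrtr_sqr ler_wsqrtr// ord1 /dotp (bigD1 i)//= -expr2 lerDl.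
by apply: sumr_ge0 => k _; rewrite -expr2 sqr_ge0.
Qed.

Lemma norm_le_eucl n (x : 'cV[R]_n) : `|x| <= eucl x.
Proof.
apply: norm_le_coord => [|i j]; first exact: sqrtr_ge0.
rewrite -sqrtr_sqr ler_wsqrtr// ord1 (bigD1 i)//= lerDl.
by apply: sumr_ge0 => k _; rewrite sqr_ge0.
Qed.

Lemma dotp_self_continuous n : continuous (fun x : 'cV[R]_n => dotp x x).
Proof.
apply: continuous_big => [|i _]; first exact: add_continuous.
by move=> x; apply: (@continuousM R 'cV[R]_n); exact: coord_continuous.
Qed.

Lemma eucl_continuous m : continuous (@eucl R m).
Proof.
move=> x; apply: (@continuous_comp 'cV[R]_m R R); last exact: sqrt_continuous.
exact: dotp_self_continuous.
Qed.

(** Nearest for the Euclidean norm: the orthogonality in the proximal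
    inequality below needs the inner product. *)
Definition nearest_point n (K : set 'cV[R]_n) (x p : 'cV[R]_n) :=
  K p /\ forall y, K y -> dotp (x - p) (x - p) <= dotp (x - y) (x - y).

(** Only the points of [K] no farther from [x] than some given one compete, and
    they form a compact set. *)
Lemma nearest_point_ex n (K : set 'cV[R]_n) (x : 'cV[R]_n) :
  closed K -> K !=set0 -> exists p, nearest_point K x p.
Proof.
move=> clK [y0 Ky0].
pose d (y : 'cV[R]_n) := dotp (x - y) (x - y).
have cd : continuous d.
  move=> y; apply: (@continuous_comp 'cV[R]_n 'cV[R]_n R (fun y => x - y)
    (fun z => dotp z z)); last exact: dotp_self_continuous.
  apply: (@lipschitz_continuous _ _ _ 1) => a b.
  by rewrite mul1r opprB addrC addrA subrK distrC.
pose A := K `&` [set y | d y <= d y0].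
have clA : closed A.
  apply: closedI => //; apply: (closed_comp (f := d) (D := [set z | z <= d y0])).
    by move=> *; exact: cd.
  exact: closed_le.
have bA y : A y -> `|y| <= `|x| + (d y0 + 1).
  move=> [_ /= dy].
  have xy : `|x - y| <= d y0 + 1.
    have : `|x - y| ^+ 2 <= d y0 by exact: le_trans (norm_le_dotp _) dy.
    have := normr_ge0 (x - y); nra.
  have -> : y = x - (x - y) by rewrite opprB addrC subrK.
  by rewrite (le_trans (ler_normB _ _))// lerD2l.
have A0 : A !=set0 by exists y0; split=> /=.
have [||p /[!inE] -[Kp dp] pmin] := @compact_EVT_min _ _ d A A0.
- exact: closed_bounded_compact clA bA.
- exact: continuous_subspaceT.
exists p; split => // y Ky.
have [dy|/ltW dy] := leP (d y) (d y0); first by apply: pmin; rewrite inE.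
exact: le_trans dp dy.
Qed.

Section Norm.
Variables (n : nat) (N : 'cV[R]_n -> R).
Hypothesis hN : is_norm N.

Lemma is_norm0 : N 0 = 0.
Proof. by case: hN => _ NZ _; rewrite -(scale0r 0) NZ normr0 mul0r. Qed.

Lemma is_normN x : N (- x) = N x.
Proof. by case: hN => _ NZ _; rewrite -scaleN1r NZ normrN1 mul1r. Qed.

Lemma is_norm_ge0 x : 0 <= N x.
Proof.
case: hN => ND _ _.
by have := ND x (- x); rewrite subrr is_norm0 is_normN -mulr2n pmulrn_lge0.
Qed.

Lemma is_norm_le : exists2 C : R, 0 < C & forall x, N x <= C * `|x|.
Proof.
case: hN => ND NZ _.
exists (\sum_i N (delta_mx i 0) + 1).
  by rewrite ltr_wpDl// sumr_ge0// => i _; exact: is_norm_ge0.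
move=> x; rewrite {1}(matrix_sum_delta x).
under eq_bigr do rewrite big_ord1.
apply: (@le_trans _ _ (\sum_i `|x| * N (delta_mx i 0))).
  elim/big_ind2 : _ => [|a b c d ab cd|i _]; first by rewrite is_norm0.
    exact: le_trans (ND _ _) (lerD ab cd).
  by rewrite NZ ler_wpM2r ?is_norm_ge0// coord_le_norm.
by rewrite -mulr_sumr mulrC ler_wpM2r// lerDl.
Qed.

Lemma is_norm_continuous : continuous N.
Proof.
have [C C0 NC] := is_norm_le.
case: hN => ND NZ _.
apply: (@lipschitz_continuous 'cV[R]_n R^o N C) => x y.
apply: le_trans (NC (x - y)).
have := ND (x - y) y; have := ND (y - x) x; rewrite !subrK -(opprB x y) is_normN.
by rewrite ler_norml => *; apply/andP; split; lra.
Qed.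

Lemma unit_sphere_compact : compact [set x | `|x : 'cV[R]_n| = 1].
Proof.
apply: (@closed_bounded_compact _ _ 1); last by move=> x /= ->.
apply: (closed_comp (f := fun x : 'cV[R]_n => `|x|) (D := [set z | z = 1])).
  by move=> x _; exact: norm_continuous.
exact: closed_eq.
Qed.

(** The norm attains a positive minimum on the compact sphere of the sup norm. *)
Lemma is_norm_ge : exists2 c : R, 0 < c & forall x, c * `|x| <= N x.
Proof.
have [[x0 x01]|sph0] := pselect ([set x | `|x : 'cV[R]_n| = 1] !=set0); last first.
  exists 1 => // x; rewrite mul1r.
  have [->|x0] := eqVneq x 0; first by rewrite normr0 is_norm_ge0.
  exfalso; apply: sph0; exists (`|x|^-1 *: x) => /=.
  by rewrite normrZ normfV normr_id mulVf// normr_eq0.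
have [|p p1 pmin] := compact_EVT_min (ex_intro _ x0 x01) unit_sphere_compact (f := N).
  by apply: continuous_subspaceT; exact: is_norm_continuous.
case: hN => _ NZ N0; exists (N p).
  rewrite lt_neqAle is_norm_ge0 andbT eq_sym; apply/eqP => /N0 p0.
  by move: p1; rewrite inE /= p0 normr0 => /eqP; rewrite eq_sym oner_eq0.
move=> x; have [->|xN0] := eqVneq x 0; first by rewrite normr0 mulr0 is_norm_ge0.
have xn0 : 0 < `|x| by rewrite normr_gt0.
have : N p <= N (`|x|^-1 *: x).
  by apply: pmin; rewrite inE/= normrZ normfV normr_id mulVf// gt_eqF.
by rewrite NZ normfV normr_id ler_pdivlMl// mulrC.
Qed.

End Norm.
End EuclideanSpace.

(** * Tangent directions and nearest points *)

Section Tangency.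
Context {R : realType} {n : nat}.
Implicit Types (K : set 'cV[R]_n) (x p z : 'cV[R]_n).

(** Bouligand's cone, with the sup norm and without the infimum over [K], a
    form that linear maps visibly preserve. *)
Definition bouligand K p z := forall e d : R, 0 < e -> 0 < d ->
  exists h, [/\ 0 < h, h < d & exists2 y, K y & `|p + h *: z - y| <= e * h].

Lemma tangent_cone_bouligand (N : 'cV[R]_n -> R) K p z :
  is_norm N -> K !=set0 -> tangent_cone N K p z -> bouligand K p z.
Proof.
move=> hN [y0 Ky0]; have [c c0 Nc] := is_norm_ge hN.
rewrite /tangent_cone/= limf_einfE => lim0 e d e0 d0.
set g := (fun h : R => _) in lim0.
have : (ereal_inf (g @` [set h : R | (0 < h < d)%R]) < (e * c)%:E)%E.
  apply: (@le_lt_trans _ _ 0%E); last by rewrite lte_fin mulr_gt0.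
  rewrite -lim0; apply: ereal_sup_ubound; exists [set h : R | 0 < h < d] => //=.
  near=> h; apply/andP; split; first by [].
  near: h; exact: nbhs_right_lt.
move=> /ereal_inf_lt[_ [h /= /andP[h0 hd] <-]]; rewrite /g lte_fin mulrC.
rewrite ltr_pdivrMr// => /inf_lt[|_ [y Ky <-] Ny].
  by exists (N (p + h *: z - y0)); exists y0.
exists h; split => //; exists y => //; rewrite -(ler_pM2l c0).
by rewrite (le_trans (Nc _))// mulrA (mulrC c) ltW.
Unshelve. all: by end_near. Qed.

(** Every direction is tangent at an interior point, so that tangency on the
    boundary amounts to tangency everywhere in [K]. *)
Lemma interior_bouligand K p z : interior K p -> bouligand K p z.
Proof.
move=> /nbhs_normP[r /= r0 rK] e d e0 d0.
have z0 : 0 < `|z| + 1 by rewrite ltr_wpDl.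
pose h := Num.min (d / 2) (r / 2 / (`|z| + 1)).
have h0 : 0 < h by rewrite lt_min !divr_gt0.
exists h; split => //.
  by rewrite /h gt_min; apply/orP; left; lra.
exists (p + h *: z); last by rewrite subrr normr0 mulr_ge0// ltW.
apply: rK; rewrite /ball_/= opprD addNKr normrN normrZ gtr0_norm//.
apply: (@le_lt_trans _ _ (r / 2)); last lra.
apply: (@le_trans _ _ (h * (`|z| + 1))).
  by rewrite ler_wpM2l ?(ltW h0)// lerDl.
by rewrite -ler_pdivlMr// /h ge_min lexx orbT.
Qed.

Lemma bouligand_mulmx K p z (A : 'M[R]_n) :
  bouligand K p z -> bouligand [set A *m y | y in K] (A *m p) (A *m z).
Proof.
move=> Kpz e d e0 d0.
have C0 : 0 < n%:R * `|A| + 1 by rewrite ltr_wpDl// mulr_ge0.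
have [|h [h0 hd [y Ky yh]]] := Kpz (e / (n%:R * `|A| + 1)) d _ d0.
  exact: divr_gt0.
exists h; split => //; exists (A *m y); first by exists y.
rewrite scalemxAr -mulmxDr -mulmxBr (le_trans (normM_mulmx _ _))//.
apply: (@le_trans _ _ ((n%:R * `|A| + 1) * `|p + h *: z - y|)).
  by rewrite ler_wpM2r// lerDl.
by rewrite mulrC -ler_pdivlMr// mulrAC.
Qed.

Lemma bouligandZ K p z (c : R) :
  0 < c -> bouligand K p z -> bouligand K p (c *: z).
Proof.
move=> c0 Kz e d e0 d0.
have [||h [h0 hd [y Ky yh]]] := Kz (e / c) (d * c); rewrite ?divr_gt0 ?mulr_gt0//.
exists (h / c); split; first exact: divr_gt0.
  by rewrite ltr_pdivrMr.
by exists y => //; rewrite scalerA divfK ?gt_eqF// mulrA mulrAC.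
Qed.

Lemma bouligandS K L p z :
  K `<=` L -> bouligand K p z -> bouligand L p z.
Proof.
move=> KL Kz e d e0 d0; have [h [h0 hd [y Ky yh]]] := Kz e d e0 d0.
by exists h; split=> //; exists y => //; exact: KL.
Qed.

(** Moving from [p] by [h z], with [<x - p, z> > 0], brings one closer to [x]
    at first order in [h], and correcting by [o(h)] to return to [K] does not
    undo this. Unlike tangency itself, the conclusion is stable under convex
    combinations of [z]. *)
Lemma bouligand_nearest K x p z :
  bouligand K p z -> nearest_point K x p -> dotp (x - p) z <= 0.
Proof.
move=> Kpz [Kp pmin]; rewrite leNgt; apply/negP => a0.
set v := x - p in pmin a0; set a := dotp v z in a0.
(* With this [e] the error [2 <v, w>] is at most [a h], and a step [h] below
   [a / (L + 1)] makes [|u|^2] smaller than [a h]: together less than [2 a h]. *)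
pose e := a / (2 * (n%:R * `|v| + 1)).
have nv0 : 0 < n%:R * `|v| + 1 by rewrite ltr_wpDl// mulr_ge0.
have e0 : 0 < e by rewrite divr_gt0// mulr_gt0.
pose L := n%:R * (e + `|z|) ^+ 2.
have L0 : 0 <= L by rewrite mulr_ge0// sqr_ge0.
have [|h [h0 hd [y Ky yh]]] := Kpz e (a / (L + 1)) e0.
  by rewrite divr_gt0// ltr_wpDl.
set w := p + h *: z - y in yh; pose u := w - h *: z.
have xyE : x - y = v + u by apply/colP => i; rewrite !mxE; ring.
have ineq := pmin y Ky.
rewrite xyE dotpDl (dotpDr v v u) (dotpDr u v u) (dotpC u v) in ineq.
have vu : dotp v u = dotp v w - h * a.
  by rewrite /u -scaleN1r !dotpDr !dotpZr -/a; ring.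
have vw : dotp v w <= n%:R * `|v| * e * h.
  rewrite (le_trans (ler_norm _))// (le_trans (dotp_le _ _))//.
  by rewrite mulrA -[leRHS]mulrA ler_wpM2l// mulr_ge0.
have nve : 2 * (n%:R * `|v| * e) <= a.
  have -> : a = 2 * ((n%:R * `|v| + 1) * e).
    by rewrite /e; field; rewrite gt_eqF.
  by rewrite ler_pM2l// ler_wpM2r ?(ltW e0)// lerDl.
have uu : dotp u u <= L * h * h.
  rewrite (le_trans (ler_norm _))// (le_trans (dotp_le _ _))//.
  have uh : `|u| <= (e + `|z|) * h.
    by rewrite mulrDl (le_trans (ler_normB _ _))// lerD// normrZ gtr0_norm// mulrC.
  have -> : L * h * h = n%:R * (((e + `|z|) * h) * ((e + `|z|) * h)).
    by rewrite /L; ring.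
  by rewrite ler_wpM2l// ler_pM.
have Lh : L * h < a.
  apply: (@le_lt_trans _ _ ((L + 1) * h)); first by rewrite ler_wpM2r ?(ltW h0)// lerDl.
  by rewrite mulrC -ltr_pdivlMr// ltr_wpDl.
have : 2 * (n%:R * `|v| * e) * h <= a * h by rewrite ler_wpM2r// ltW.
have : L * h * h < a * h by rewrite ltr_pM2r.
nra.
Qed.

End Tangency.

(** * Measurability of superpositions *)

Section MeasurableComposition.
Context {R : realType} d {T : measurableType d}.

(** The preimage of any set is a countable union of fibres of [Z]. *)
Lemma measurable_fun_discrete (I : countType) d' (U : measurableType d')
    (Z : T -> I) (g : I -> U) :
  (forall i, measurable [set t | Z t = i]) -> measurable_fun setT (g \o Z).
Proof.
move=> mZ _ B mB; rewrite setTI.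
rewrite (_ : _ @^-1` B = \bigcup_(i in [set i | B (g i)]) [set t | Z t = i]).
  rewrite bigcup_mkcond; apply: countable_bigcupT_measurable.
    exact: countableP.
  by move=> i; case: ifP => // _; exact: measurable0.
apply/seteqP; split=> [t Bt|t [i Bi Zt]]; first by exists (Z t).
by rewrite /preimage /= Zt.
Qed.

Lemma measurable_set_floor (y : T -> R) (z : int) :
  measurable_fun setT y -> measurable [set t | Num.floor (y t) = z].
Proof.
move=> my.
rewrite (_ : [set _ | _] = y @^-1` `[z%:~R, (z + 1)%:~R[).
  by rewrite -[_ @^-1` _]setTI; apply: my => //; exact: measurable_itv.
apply/seteqP; split=> t /=; rewrite in_itv/=.
  by move=> <-; rewrite floor_itv.
by move=> ?; exact: floor_def.
Qed.

Definition grid_floor n (m : nat) (x : 'cV[R]_n) : 'cV[int]_n :=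
  \col_i Num.floor (m.+1%:R * x i 0).

Definition grid_point n (m : nat) (z : 'cV[int]_n) : 'cV[R]_n :=
  \col_i ((z i 0)%:~R / m.+1%:R).

Lemma grid_cvg n (x : 'cV[R]_n) :
  grid_point m (grid_floor m x) @[m --> \oo] --> x.
Proof.
apply/cvgrPdist_le => e e0; near=> m.
have m0 : 0 < m.+1%:R :> R by [].
apply: norm_le_coord => [|i j]; first exact: ltW.
rewrite ord1 !mxE; set a := m.+1%:R * x i 0.
have -> : x i 0 = a / m.+1%:R by rewrite /a mulrC mulKf ?gt_eqF.
rewrite -mulrBl normrM (@ger0_norm _ (_^-1))//.
apply: (@le_trans _ _ m.+1%:R^-1).
  rewrite ler_piMl ?invr_ge0//.
  have /andP[] := floor_itv a; rewrite intrD => f1 f2.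
  by rewrite ler_norml; apply/andP; split; lra.
by apply/ltW; near: m; exact: (near_infty_natSinv_lt (PosNum e0)).
Unshelve. all: by end_near. Qed.

(** Rounding the coordinates of [y] down to a grid of mesh [1 / m.+1] factors
    the map through a countable type; then the mesh tends to zero. *)
Lemma measurable_comp_continuous n (g : 'cV[R]_n -> R) (y : T -> 'cV[R]_n) :
  continuous g -> (forall i, measurable_fun setT (fun t => y t i 0)) ->
  measurable_fun setT (g \o y).
Proof.
move=> cg my.
apply: (measurable_fun_cvg
  (h := fun m => (g \o @grid_point n m) \o (@grid_floor n m \o y))).
  move=> m; apply: measurable_fun_discrete => z.
  rewrite (_ : [set _ | _] = \bigcap_(i in [set: 'I_n])
      [set t | Num.floor (m.+1%:R * y t i 0) = z i 0]).
    apply: fin_bigcap_measurable => // i _.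
    by apply: measurable_set_floor; exact: measurable_funM.
  apply/seteqP; split=> t /=.
    by move=> <- i _; rewrite /= !mxE.
  by move=> tz; apply/colP => i; rewrite mxE tz.
move=> t _.
exact: (cvg_comp _ g (@grid_cvg n (y t)) (cg (y t))).
Qed.

End MeasurableComposition.

(** * Integrals of bounded vector fields *)

Section VectorIntegral.
Context {R : realType} {n : nat}.
Local Notation mu := (@lebesgue_measure R).
Implicit Types (u : R -> 'cV[R]_n) (a b c M : R).

(** A single [M] serves at once for integrability on bounded intervals, for the
    Lipschitz constant of the primitive and for domination. *)
Definition measurable_bounded u M :=
  (forall i, measurable_fun setT (fun s => u s i 0)) /\ forall s, `|u s| <= M.

Definition vint u a b : 'cV[R]_n :=
  \col_i \int[mu]_(s in `]a, b]) u s i 0.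

Lemma measurable_bounded_ge0 u M : measurable_bounded u M -> 0 <= M.
Proof. by case=> _ /(_ 0); exact: le_trans. Qed.

Lemma bounded_integrable_itv (g : R -> R) a b M : measurable_fun setT g ->
  (forall s, `|g s| <= M) -> mu.-integrable `]a, b] (EFin \o g).
Proof.
move=> mg bg; apply: measurable_bounded_integrable => //.
- by rewrite [X in (X < _)%E]lebesgue_measure_itv/=; case: ifP; rewrite -?EFinB ltry.
- exact: measurable_funS mg.
- exists M; split; first exact: num_real.
  by move=> M' MM' s _ /=; exact: le_trans (bg s) (ltW MM').
Qed.

Lemma measurable_bounded_itv u M a b i : measurable_bounded u M ->
  mu.-integrable `]a, b] (EFin \o (fun s => u s i 0)).
Proof.
move=> [mu_ bu]; apply: (@bounded_integrable_itv _ _ _ M) => // s.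
exact: le_trans (coord_le_norm _ _ _) (bu s).
Qed.

Lemma eq_vint u w a b : (forall s, a < s <= b -> u s = w s) ->
  vint u a b = vint w a b.
Proof.
move=> uw; apply/colP => i; rewrite !mxE; apply: eq_Rintegral => s.
by rewrite inE/= in_itv/= => /uw ->.
Qed.

Lemma vint_nil u a : vint u a a = 0.
Proof. by apply/colP => i; rewrite !mxE set_itvoc0 Rintegral_set0. Qed.

Lemma vint_cat u M a b c : measurable_bounded u M -> a <= b -> b <= c ->
  vint u a c = vint u a b + vint u b c.
Proof.
move=> bu ab bc; apply/colP => i; rewrite !mxE.
have := @Rintegral_itvB R (fun s => u s i 0) (BRight a) (BRight c) b
  (measurable_bounded_itv a c i bu).
rewrite !bnd_simp => /(_ ab bc) <-; ring.
Qed.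

Lemma itv_oc_length a b : a <= b -> fine (mu `]a, b]) = b - a.
Proof.
rewrite lebesgue_measure_itv/= lte_fin le_eqVlt => /predU1P[->|ab].
  by rewrite ltxx subrr.
by rewrite ab.
Qed.

Lemma norm_vint_le u M a b : measurable_bounded u M -> a <= b ->
  `|vint u a b| <= M * (b - a).
Proof.
move=> bu ab; have M0 := measurable_bounded_ge0 bu.
apply: norm_le_coord => [|i j]; first by rewrite mulr_ge0// subr_ge0.
have iu := measurable_bounded_itv a b i bu.
rewrite mxE (le_trans (le_normr_Rintegral _ iu))// -itv_oc_length//.
rewrite -Rintegral_cst//; apply: le_Rintegral => //.
- exact: (@integrable_norm _ _ _ mu _ _ iu).
- exact: (@bounded_integrable_itv _ _ _ `|M|).
- by move=> s _; exact: le_trans (coord_le_norm _ _ _) (bu.2 s).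
Qed.

Lemma dotp_vint u M a b (v : 'cV[R]_n) : measurable_bounded u M ->
  dotp v (vint u a b) = \int[mu]_(s in `]a, b]) dotp v (u s).
Proof.
move=> bu; rewrite /dotp.
under eq_bigr do rewrite mxE.
have sumE (r : seq 'I_n) :
    \sum_(i <- r) v i 0 * (\int[mu]_(s in `]a, b]) u s i 0) =
    \int[mu]_(s in `]a, b]) (\sum_(i <- r) v i 0 * u s i 0).
  elim: r => [|i r IH].
    rewrite big_nil; under eq_Rintegral do rewrite big_nil.
    by rewrite Rintegral_cst// mul0r.
  rewrite big_cons IH -RintegralZl//; last exact: measurable_bounded_itv bu.
  rewrite -RintegralD//; first by apply: eq_Rintegral => s _; rewrite big_cons.
  - apply: (@bounded_integrable_itv _ _ _ (`|v i 0| * M)) => [|s].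
      by apply: measurable_funM => //; exact: bu.1.
    by rewrite normrM ler_wpM2l// (le_trans (coord_le_norm _ _ _))// bu.2.
  - apply: (@bounded_integrable_itv _ _ _ (\sum_(i <- r) `|v i 0| * M)) => [|s].
      by apply: measurable_sum => k; apply: measurable_funM => //; exact: bu.1.
    rewrite (le_trans (ler_norm_sum _ _ _))//; apply: ler_sum => k _.
    by rewrite normrM ler_wpM2l// (le_trans (coord_le_norm _ _ _))// bu.2.
exact: sumE.
Qed.

(** This is the step that lets the proximal inequality pass from the field to
    its integral. *)
Lemma dotp_vint_le0 u M a b (v : 'cV[R]_n) : measurable_bounded u M ->
  (forall s, a < s <= b -> dotp v (u s) <= 0) -> dotp v (vint u a b) <= 0.
Proof.
move=> bu vu; rewrite (dotp_vint _ _ _ bu).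
rewrite -oppr_ge0 -mulN1r -RintegralZl//; last first.
  apply: (@bounded_integrable_itv _ _ _ (n%:R * (`|v| * M))) => [|s].
    by apply: measurable_sum => k; apply: measurable_funM => //; exact: bu.1.
  by rewrite (le_trans (dotp_le _ _))// !ler_wpM2l// bu.2.
apply: Rintegral_ge0 => s /=; rewrite in_itv/= => /vu ?.
by rewrite mulN1r oppr_ge0.
Qed.

Lemma vint_cvg (u_ : nat -> R -> 'cV[R]_n) u M a b :
  (forall m, measurable_bounded (u_ m) M) -> measurable_bounded u M ->
  (forall s, a < s <= b -> u_ m s @[m --> \oo] --> u s) ->
  vint (u_ m) a b @[m --> \oo] --> vint u a b.
Proof.
move=> bu_ bu u_u.
have coordcvg i : vint (u_ m) a b i 0 @[m --> \oo] --> vint u a b i 0.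
  rewrite mxE; under eq_fun do rewrite mxE.
  apply: fine_cvg; rewrite fineK; last first.
    by apply: integrable_fin_num => //; exact: measurable_bounded_itv bu.
  apply: (@dominated_cvg _ _ _ mu _ _ (fun m s => (u_ m s i 0)%:E)
    (fun s => (u s i 0)%:E) (fun=> M%:E)) => //.
  - by move=> m; apply/measurable_EFinP; apply: measurable_funS ((bu_ m).1 i).
  - move=> s /=; rewrite in_itv/= => sab.
    apply: cvg_EFin; first by apply: nearW.
    exact: (cvg_comp _ (fun v : 'cV[R]_n => v i 0) (u_u s sab)
      (@coord_continuous R n 1 i 0 (u s))).
  - exact: (@bounded_integrable_itv _ _ _ `|M|).
  - move=> m s _; rewrite lee_fin.
    exact: le_trans (coord_le_norm _ _ _) ((bu_ m).2 s).
apply/cvgrPdist_le => e e0.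
have : \forall m \near \oo, forall i,
    `|vint u a b i 0 - vint (u_ m) a b i 0| <= e.
  apply: filter_forall => i.
  by have /cvgrPdist_le/(_ e e0) := coordcvg i.
apply: filterS => m um; apply: norm_le_coord => [|i j]; first exact: ltW.
by have := um i; rewrite ord1 !mxE.
Qed.

(** Lebesgue differentiation, one coordinate at a time. *)
Lemma vint_is_derive u M a : measurable_bounded u M ->
  {ae mu, forall t, a < t -> is_derive t 1 (vint u a) (u t)}.
Proof.
move=> bu.
have lu i : locally_integrable setT (fun s => u s i 0).
  split; [exact: bu.1|exact: openT|move=> K _ cK].
  have mK := compact_measurable cK; have fK := compact_finite_measure cK.
  apply: (@le_lt_trans _ _ (\int[mu]_(x in K) (cst M%:E x))%E); last first.
    by rewrite integral_cst// lte_mul_pinfty ?lee_fin ?(measurable_bounded_ge0 bu).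
  apply: ge0_le_integral => //=.
  - apply/measurable_EFinP/measurableT_comp => //.
    exact: measurable_funS (bu.1 i).
  - move=> s _; rewrite lee_fin.
    exact: le_trans (coord_le_norm _ _ _) (bu.2 s).
have : {ae mu, forall t (i : 'I_n), lebesgue_pt (fun s => u s i 0) t}.
  apply: (@filter_forall _ _ _ _ (ae_filter_ringOfSetsType mu)) => i.
  exact: lebesgue_differentiation.
apply: filterS; first exact: (ae_filter_ringOfSetsType mu).
move=> t tpt at_.
have coordF i : derivable (fun r => vint u a r i 0) t 1 /\
    derive1 (fun r => vint u a r i 0 : R) t = u t i 0.
  rewrite (_ : (fun r => vint u a r i 0) =
      fun r => \int[mu]_(s in `]a, r]) u s i 0); last first.
    by apply/funext => r; rewrite mxE.
  apply: (@FTC1_lebesgue_pt R _ (BRight a) t (t + 1)) => //.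
  - by rewrite ltrDl.
  - exact: measurable_bounded_itv bu.
have dF : derivable (vint u a) t 1.
  by apply/derivable_mxP => i j; rewrite ord1; exact: (coordF i).1.
split => //; rewrite derive_mx//; apply/colP => i.
by rewrite mxE -(coordF i).2 derive1E.
Qed.

End VectorIntegral.

(** * Compactness of equi-Lipschitz curves *)

Section EquiLipschitz.
Context {R : realType} {n : nat}.

(** Tychonoff: [Y] is a cluster point of the sequence for pointwise
    convergence. *)
Lemma pointwise_cluster (X : nat -> R -> 'cV[R]_n) (B : R) :
  (forall m t, `|X m t| <= B) ->
  exists Y : R -> 'cV[R]_n, forall (l : seq R) (e : R) (N : nat), 0 < e ->
    exists2 m, (N <= m)%N & forall t, t \in l -> `|X m t - Y t| < e.
Proof.
move=> XB.
pose A (t : R) := [set v : 'cV[R]_n | `|v| <= B].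
have cA t : compact (A t).
  apply: (@closed_bounded_compact _ _ _ B) => //.
  apply: (closed_comp (f := fun x : 'cV[R]_n => `|x|) (D := [set z | z <= B])).
    by move=> x _; exact: norm_continuous.
  exact: closed_le.
have [Y [_ clY]] : [set f : forall t : R, 'cV[R]_n | forall t, A t (f t)] `&`
    @cluster (prod_topology (fun _ : R => 'cV[R]_n)) (X @ \oo) !=set0.
  apply: (tychonoff cA); exists 0%N => // m _ t; exact: XB.
exists Y => l e N e0.
have nbY : @nbhs _ (prod_topology (fun _ : R => 'cV[R]_n)) Y
    [set g : R -> 'cV[R]_n | forall t, t \in l -> `|g t - Y t| < e].
  elim: l => [|r l IH]; first exact: (@filterE _ (nbhs (Y : prod_topology _))).
  have : @nbhs _ (prod_topology (fun _ : R => 'cV[R]_n)) Y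
      [set g : R -> 'cV[R]_n | `|g r - Y r| < e].
    have := @proj_continuous R (fun=> 'cV[R]_n) r Y _ (nbhsx_ballx (Y r) e e0).
    apply: (@filterS _ (nbhs (Y : prod_topology _))) => g.
    by rewrite -ball_normE /ball_/= distrC.
  move: IH; apply: (@filterS2 _ (nbhs (Y : prod_topology _))) => g gl gr t.
  by rewrite inE => /predU1P[->//|]; exact: gl.
have XN : (X @ \oo) [set X m | m in [set m | (N <= m)%N]].
  by exists N => // m Nm; exists m.
by have [_ [[m Nm <-] Xm]] := clY _ _ XN nbY; exists m.
Qed.

(** A cluster point of an equi-Lipschitz sequence is approached within
    [1 / j.+1] on a grid of mesh [1 / j.+1] by some term [k j], hence within
    [(2 M + 1) / j.+1] on the whole interval. *)
Lemma equilipschitz_subsequence (X : nat -> R -> 'cV[R]_n) (B M a : R) :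
  0 <= M -> (forall m t, `|X m t| <= B) ->
  (forall m s t, `|X m s - X m t| <= M * `|s - t|) ->
  exists (k : nat -> nat) (Y : R -> 'cV[R]_n),
    [/\ forall j, (j <= k j)%N,
        forall t, a <= t <= a + 1 -> X (k j) t @[j --> \oo] --> Y t &
        forall s t, `|Y s - Y t| <= M * `|s - t|].
Proof.
move=> M0 XB XM; have [Y XY] := pointwise_cluster XB.
pose l j := [seq a + i%:R / j.+1%:R | i <- iota 0 j.+2].
have kP j : exists m, (j <= m)%N /\ forall t, t \in l j -> `|X m t - Y t| < j.+1%:R^-1.
  by have [|m jm Xm] := XY (l j) (j.+1%:R^-1) j; [rewrite invr_gt0|exists m].
have [k {}kP] := choice kP.
have YM s t : `|Y s - Y t| <= M * `|s - t|.
  apply/ler_addgt0Pr => e e0.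
  have [|m _ Xm] := XY [:: s; t] (e / 2) 0%N; first exact: divr_gt0.
  have Xs : `|X m s - Y s| < e / 2 by apply: Xm; rewrite !inE eqxx.
  have Xt : `|X m t - Y t| < e / 2 by apply: Xm; rewrite !inE eqxx orbT.
  have -> : Y s - Y t = (X m s - X m t) - (X m s - Y s) + (X m t - Y t).
    by apply/colP => i; rewrite !mxE; ring.
  rewrite (le_trans (ler_normD _ _))//.
  have := ler_normB (X m s - X m t) (X m s - Y s); have := XM m s t; lra.
exists k, Y; split => // [j|t /andP[at_ ta]]; first exact: (kP j).1.
apply/cvgrPdist_le => e e0.
have C0 : 0 < 2 * M + 1 by lra.
have eC0 : 0 < e / (2 * M + 1) by exact: divr_gt0.
near=> j.
have j0 : 0 < j.+1%:R :> R by [].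
pose i := Num.trunc ((t - a) * j.+1%:R).
have ta0 : 0 <= (t - a) * j.+1%:R by rewrite mulr_ge0// subr_ge0.
have /andP[i1 i2] := Num.Theory.truncn_itv ta0.
rewrite -/i in i1 i2.
pose r := a + i%:R / j.+1%:R.
have tE : t - r = ((t - a) * j.+1%:R - i%:R) / j.+1%:R.
  by rewrite /r mulrBl mulfK ?gt_eqF// opprD addrA.
have tr : `|t - r| <= j.+1%:R^-1.
  rewrite tE normrM [`|_^-1|]gtr0_norm ?invr_gt0// ler_piMl ?invr_ge0//.
  by rewrite ler_norml; move: i2; rewrite -natr1 => i2; apply/andP; split; lra.
have rl : r \in l j.
  apply/mapP; exists i => //.
  rewrite mem_iota/= add0n ltnS -(ler_nat R) (le_trans i1)//.
  by rewrite ler_piMl//; lra.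
have Xr := ltW ((kP j).2 r rl).
have -> : Y t - X (k j) t = (Y t - Y r) - (X (k j) t - X (k j) r) - (X (k j) r - Y r).
  by apply/colP => b; rewrite !mxE; ring.
have Ytr : `|Y t - Y r| <= M * j.+1%:R^-1.
  by apply: le_trans (YM _ _) _; rewrite ler_wpM2l.
have Xtr : `|X (k j) t - X (k j) r| <= M * j.+1%:R^-1.
  by apply: le_trans (XM _ _ _) _; rewrite ler_wpM2l.
apply: (@le_trans _ _ ((2 * M + 1) * j.+1%:R^-1)).
  rewrite (le_trans (ler_normB _ _))//.
  have := ler_normB (Y t - Y r) (X (k j) t - X (k j) r).
  by set inv := _^-1 in Xr Ytr Xtr *; nra.
rewrite mulrC -ler_pdivlMr//; apply/ltW.
by near: j; exact: (near_infty_natSinv_lt (PosNum eC0)).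
Unshelve. all: by end_near. Qed.

End EquiLipschitz.

(** * Euler polygons and viable solutions *)

Section EulerPolygons.
Context {R : realType} {n : nat}.
Variables (F : R -> 'cV[R]_n -> 'cV[R]_n) (M : R) (K : set 'cV[R]_n).
Variables (a : R) (x0 : 'cV[R]_n).
Hypothesis F_measurable : forall y : R -> 'cV[R]_n,
  (forall i, measurable_fun setT (fun s => y s i 0)) ->
  forall i, measurable_fun setT (fun s => F s (y s) i 0).
Hypothesis F_bounded : forall s x, `|F s x| <= M.
Hypothesis F_nearest : forall s x p,
  nearest_point K x p -> dotp (x - p) (F s p) <= 0.
Hypothesis Kx0 : K x0.

Variable proj : 'cV[R]_n -> 'cV[R]_n.
Hypothesis projP : forall x, nearest_point K x (proj x).

Local Notation step m := (m.+1%:R^-1 : R).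

Fixpoint euler_node (m j : nat) : 'cV[R]_n :=
  if j is i.+1 then
    euler_node m i + vint (fun s => F s (proj (euler_node m i)))
                          (a + i%:R * step m) (a + i.+1%:R * step m)
  else x0.

(** The index of the step that contains [s]. Steps are open on the left, which
    is why this is a ceiling minus one. *)
Definition euler_index (m : nat) (s : R) : nat :=
  `|Num.ceil ((s - a) * m.+1%:R)|%N.-1.

Definition euler_proj (m : nat) (s : R) : 'cV[R]_n :=
  proj (euler_node m (euler_index m s)).

Definition euler_polygon (m : nat) (t : R) : 'cV[R]_n :=
  x0 + vint (fun s => F s (euler_proj m s)) a t.

Lemma euler_bound_ge0 : 0 <= M. Proof. exact: le_trans (F_bounded 0 0). Qed.

Lemma F_measurable_bounded (y : R -> 'cV[R]_n) :
  (forall i, measurable_fun setT (fun s => y s i 0)) ->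
  measurable_bounded (fun s => F s (y s)) M.
Proof. by move=> my; split=> // i; exact: F_measurable. Qed.

Lemma euler_indexP m s : a < s ->
  a + (euler_index m s)%:R * step m < s <= a + (euler_index m s).+1%:R * step m.
Proof.
move=> as_; rewrite /euler_index; set x := (s - a) * m.+1%:R.
have x0_ : 0 < x by rewrite mulr_gt0// subr_gt0.
have c0 : 0 < Num.ceil x by rewrite ceil_gt0.
have [j cE] : exists j : nat, Num.ceil x = j.+1.
  by case: (Num.ceil x) c0 => [[|j]|]// _; exists j.
have sE : s = a + x * step m by rewrite /x mulfK ?gt_eqF// addrC subrK.
have /andP[] := ceil_itv x; rewrite cE /= => x1 x2.
rewrite [in X in _ < X]sE [in X in X <= _]sE ltrD2l lerD2l.
rewrite ltr_pM2r ?invr_gt0// ler_pM2r ?invr_gt0// x2 andbT.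
by move: x1; rewrite -addn1 PoszD addrK.
Qed.

Lemma euler_index_eq m j s :
  a + j%:R * step m < s <= a + j.+1%:R * step m -> euler_index m s = j.
Proof.
move=> /andP[js sj].
have as_ : a < s by apply: le_lt_trans js; rewrite lerDl mulr_ge0.
have /andP[is_ si] := euler_indexP m as_.
have m0 : 0 < step m by rewrite invr_gt0.
apply/eqP; rewrite eqn_leq -ltnS -[X in _ && X]ltnS -!(ltr_nat R).
apply/andP; split.
  by have := lt_le_trans is_ sj; rewrite ltrD2l ltr_pM2r.
by have := lt_le_trans js si; rewrite ltrD2l ltr_pM2r.
Qed.

Lemma euler_proj_measurable m i :
  measurable_fun setT (fun s => euler_proj m s i 0).
Proof.
rewrite (_ : (fun s => _) = (fun z : int => proj (euler_node m (`|- z|%N.-1)) i 0)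
    \o (fun s => Num.floor (- ((s - a) * m.+1%:R)))); last first.
  by apply/funext => s; rewrite /euler_proj /euler_index /= ceilNfloor.
apply: measurable_fun_discrete => z.
apply: measurable_set_floor; apply: measurableT_comp => //.
by apply: measurable_funM => //; exact: measurable_funB.
Qed.

Lemma euler_field_measurable_bounded m :
  measurable_bounded (fun s => F s (euler_proj m s)) M.
Proof. by apply: F_measurable_bounded => i; exact: euler_proj_measurable. Qed.

Lemma euler_polygonB m s t : a <= s -> s <= t ->
  euler_polygon m t =
  euler_polygon m s + vint (fun s => F s (euler_proj m s)) s t.
Proof.
move=> as_ st; rewrite /euler_polygon.
by rewrite (vint_cat (euler_field_measurable_bounded m) as_ st) addrA.
Qed.

Lemma euler_polygon_lipschitz m s t : a <= s -> s <= t ->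
  `|euler_polygon m t - euler_polygon m s| <= M * (t - s).
Proof.
move=> as_ st; rewrite (euler_polygonB m as_ st) addrAC subrr add0r.
exact: norm_vint_le (euler_field_measurable_bounded m) st.
Qed.

Lemma euler_polygon_node m j : euler_polygon m (a + j%:R * step m) = euler_node m j.
Proof.
elim: j => [|j IH] /=.
  by rewrite /euler_polygon mul0r addr0 vint_nil addr0.
have st0 : 0 <= step m by rewrite invr_ge0.
rewrite (@euler_polygonB m (a + j%:R * step m)) ?lerDl ?mulr_ge0//;
  last by rewrite lerD2l ler_wpM2r// ler_nat.
rewrite IH; congr (_ + _); apply: eq_vint => s /euler_index_eq sj.
by rewrite /euler_proj sj.
Qed.

Let dist2 x := dotp (x - proj x) (x - proj x).

(** With [e] a node, [p] its nearest point and [I] the increment of the step,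
    the next node is within [|e - p + I|] of [K], and in
    [|e - p|^2 + 2 <e - p, I> + |I|^2] the middle term is nonpositive: the
    squared distance grows by at most [O(h^2)] per step. *)
Lemma euler_node_dist m j :
  dist2 (euler_node m j) <= j%:R * (n%:R * (M * step m) ^+ 2).
Proof.
elim: j => [|j IH].
  rewrite /dist2 mul0r (le_trans ((projP _).2 _ Kx0))//= subrr /dotp.
  by rewrite big1// => i _; rewrite mxE mul0r.
set e := euler_node m j in IH *; set p := proj e.
have [Kp _] := projP e; have [_ minp] := projP (euler_node m j.+1).
apply: (le_trans (minp p Kp)).
set I := vint (fun s => F s p) (a + j%:R * step m) (a + j.+1%:R * step m).
have -> : euler_node m j.+1 - p = (e - p) + I by rewrite /= -/e -/p -/I addrAC.
have mF : measurable_bounded (fun s => F s p) M.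
  by apply: F_measurable_bounded => i; exact: measurable_cst.
have eI : dotp (e - p) I <= 0.
  by apply: (dotp_vint_le0 mF) => s _; apply: F_nearest; exact: projP.
have st0 : 0 <= step m by rewrite invr_ge0.
have nI : `|I| <= M * step m.
  have -> : step m = (a + j.+1%:R * step m) - (a + j%:R * step m).
    by rewrite -natr1; ring.
  by apply: (norm_vint_le mF); rewrite lerD2l ler_wpM2r// ler_nat.
have II : dotp I I <= n%:R * (M * step m) ^+ 2.
  rewrite (le_trans (ler_norm _))// (le_trans (dotp_le _ _))//.
  by rewrite ler_wpM2l// expr2 ler_pM.
rewrite dotpDl (dotpDr (e - p) (e - p) I) (dotpDr I (e - p) I) (dotpC I (e - p)).
rewrite -[j.+1%:R]natr1 [leRHS]mulrDl mul1r.
rewrite addrA lerD// (le_trans _ IH)// -addrA gerDl.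
by have := lerD eI eI; rewrite addr0.
Qed.

(** There are at most [m.+1] steps in a unit of time, so the squared distance
    of a node to [K] is at most [n M^2 / m.+1]. *)
Lemma euler_proj_polygon m s : a < s -> s <= a + 1 ->
  `|euler_proj m s - euler_polygon m s| <=
  Num.sqrt (n%:R * M ^+ 2 * step m) + M * step m.
Proof.
move=> as_ sa; have /andP[js sj] := euler_indexP m as_.
set j := euler_index m s in js sj.
have st0 : 0 < step m by rewrite invr_gt0.
rewrite /euler_proj -/j.
have -> : proj (euler_node m j) - euler_polygon m s =
   - (euler_node m j - proj (euler_node m j)) -
   (euler_polygon m s - euler_node m j) by rewrite opprB opprB addrA subrK.
rewrite (le_trans (ler_normB _ _))// normrN lerD//.
  have jm : j%:R * step m <= 1.
    by have := lt_le_trans js sa; rewrite ltrD2l => /ltW.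
  rewrite -[leLHS]normr_id -sqrtr_sqr ler_wsqrtr//.
  apply: (le_trans (norm_le_dotp _)); apply: (le_trans (euler_node_dist _ _)).
  rewrite exprMn [_ ^+ 2 in leLHS]expr2.
  have -> : j%:R * (n%:R * (M ^+ 2 * (step m * step m))) =
     (n%:R * M ^+ 2 * step m) * (j%:R * step m) by ring.
  by rewrite ler_piMr// mulr_ge0 ?(ltW st0)// mulr_ge0// sqr_ge0.
rewrite -euler_polygon_node (le_trans (euler_polygon_lipschitz _ _ (ltW js)))//.
  by rewrite lerDl mulr_ge0// ltW.
rewrite ler_wpM2l ?euler_bound_ge0// lerBlDl (le_trans sj)//.
by rewrite -[j.+1%:R]natr1 mulrDl mul1r addrA.
Qed.

Lemma stopped_polygon_lipschitz m s t :
  `|euler_polygon m (Num.max a s) - euler_polygon m (Num.max a t)| <=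
  M * `|s - t|.
Proof.
wlog st : s t / s <= t.
  by have [st|/ltW st] := leP s t => H; [|rewrite distrC (distrC s)]; exact: H.
rewrite distrC (distrC s) (ger0_norm (_ : 0 <= t - s)) ?subr_ge0//.
have mst : Num.max a s <= Num.max a t by rewrite ge_max le_max lexx/= le_max st orbT.
rewrite (le_trans (euler_polygon_lipschitz _ _ mst)) ?le_max ?lexx//.
rewrite ler_wpM2l ?euler_bound_ge0//.
by rewrite /Num.max; case: ifP => sa; case: ifP => ta; lra.
Qed.

End EulerPolygons.

Section Viability.
Context {R : realType} {n : nat}.
Variables (F : R -> 'cV[R]_n -> 'cV[R]_n) (M : R) (K : set 'cV[R]_n).
Variables (a : R) (x0 : 'cV[R]_n).
Hypothesis F_measurable : forall y : R -> 'cV[R]_n,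
  (forall i, measurable_fun setT (fun s => y s i 0)) ->
  forall i, measurable_fun setT (fun s => F s (y s) i 0).
Hypothesis F_continuous : forall s, continuous (F s).
Hypothesis F_bounded : forall s x, `|F s x| <= M.
Hypothesis F_nearest : forall s x p,
  nearest_point K x p -> dotp (x - p) (F s p) <= 0.
Hypothesis K_closed : closed K.
Hypothesis Kx0 : K x0.

(** The polygons and the points of [K] at which their velocities are sampled
    have the same limit [Y]. The former give the integral equation, the latter
    show that [Y] stays in [K]. *)
Lemma viable_solution : exists y : R -> 'cV[R]_n,
  [/\ y a = x0,
      forall t, a <= t <= a + 1 -> K (y t),
      measurable_bounded (fun s => F s (y s)) M &
      forall t, a <= t <= a + 1 -> y t = x0 + vint (fun s => F s (y s)) a t].
Proof.
have [proj projP] := choice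
  (fun x => nearest_point_ex x K_closed (ex_intro _ x0 Kx0)).
have M0 : 0 <= M by exact: le_trans (F_bounded 0 0).
pose P := euler_polygon F a x0 proj.
have aP t : a <= Num.max a t by rewrite le_max lexx.
(* Freezing the polygons outside [[a, a + 1]] makes them bounded and
   [M]-Lipschitz on the whole line. *)
pose X m t := P m (Num.max a (Num.min t (a + 1))).
have XM m s t : `|X m s - X m t| <= M * `|s - t|.
  apply: le_trans (stopped_polygon_lipschitz a x0 F_measurable F_bounded
    proj _ _ _) _.
  rewrite ler_wpM2l//.
  have st := ler_norm (s - t); have ts := ler_norm (t - s); rewrite distrC in ts.
  by case: (leP s (a + 1)) => sa; case: (leP t (a + 1)) => ta;
    rewrite ler_norml; apply/andP; split; lra.
have XB m t : `|X m t| <= `|x0| + M.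
  have Xa : X m a = x0.
    by rewrite /X min_l ?lerDl// maxxx /P /euler_polygon vint_nil addr0.
  have -> : X m t = x0 + (X m t - X m a) by rewrite Xa addrC subrK.
  rewrite (le_trans (ler_normD _ _))// lerD2l.
  rewrite /X [in X in _ - X]min_l ?lerDl// maxxx.
  rewrite (le_trans (euler_polygon_lipschitz x0 F_measurable F_bounded proj _ _ _))//.
  rewrite ler_piMr// lerBlDl ge_max lerDl ler01/= ge_min.
  by rewrite lexx orbT.
have [k [Y [kj XY YM]]] := equilipschitz_subsequence a M0 XB XM.
have X_P m t : a <= t <= a + 1 -> X m t = P m t.
  by move=> /andP[at_ ta]; rewrite /X min_l// max_r.
have Ycont : continuous Y := lipschitz_continuous YM.
have Ymeas i : measurable_fun setT (fun s => Y s i 0).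
  apply: continuous_measurable_fun => s.
  exact: (continuous_comp (Ycont s) (@coord_continuous R n 1 i 0 (Y s))).
pose Q := euler_proj F a x0 proj.
have QY s : a < s <= a + 1 -> Q (k j) s @[j --> \oo] --> Y s.
  move=> sa; pose r m := Num.sqrt (n%:R * M ^+ 2 * m.+1%:R^-1) + M * m.+1%:R^-1.
  have r0 : r m @[m --> \oo] --> 0.
    have -> : 0 = Num.sqrt (n%:R * M ^+ 2 * 0) + M * 0 by rewrite !mulr0 sqrtr0 addr0.
    apply: cvgD; last by apply: cvgMr; exact: cvg_harmonic.
    apply: (cvg_comp (fun m => n%:R * M ^+ 2 * m.+1%:R^-1) Num.sqrt);
      last exact: sqrt_continuous.
    by apply: cvgMr; exact: cvg_harmonic.
  have r_dec j m : (j <= m)%N -> r m <= r j.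
    move=> jm; have ji : m.+1%:R^-1 <= j.+1%:R^-1 :> R.
      by rewrite lef_pV2 ?posrE// ler_nat.
    by rewrite lerD ?ler_wpM2l// ler_wsqrtr// ler_wpM2l// mulr_ge0// sqr_ge0.
  apply/cvgrPdist_le => e e0.
  have e20 : 0 < e / 2 by exact: divr_gt0.
  have /andP[as_ sa1] := sa.
  have sa_ : a <= s <= a + 1 by rewrite ltW.
  have /cvgrPdist_le/(_ _ e20) Xn := XY s sa_.
  have /cvgrPdist_le/(_ _ e20) := r0; move: Xn.
  apply: filterS2 => j; rewrite X_P// => Pj.
  rewrite sub0r normrN => rj.
  have := euler_proj_polygon F_measurable F_bounded F_nearest Kx0 projP (k j) as_ sa1.
  rewrite -/(r (k j)) -/(Q (k j) s) -/(P (k j) s) => QP.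
  have -> : Y s - Q (k j) s = (Y s - P (k j) s) - (Q (k j) s - P (k j) s).
    by rewrite opprB addrA subrK.
  rewrite (le_trans (ler_normB _ _))//.
  by have := r_dec _ _ (kj j); have := ler_norm (r j); lra.
have YE t : a <= t <= a + 1 -> Y t = x0 + vint (fun s => F s (Y s)) a t.
  move=> atI; have /andP[at_ ta] := atI.
  have bQ m : measurable_bounded (fun s => F s (Q m s)) M.
    split=> // i; apply: F_measurable => {}i; exact: euler_proj_measurable.
  have bY : measurable_bounded (fun s => F s (Y s)) M.
    by split=> // i; exact: F_measurable.
  have lim : P (k j) t @[j --> \oo] --> x0 + vint (fun s => F s (Y s)) a t.
    apply: cvgD; first exact: cvg_cst.
    apply: (vint_cvg (fun j => bQ (k j)) bY) => s /andP[as_ st].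
    apply: (cvg_comp (fun j => Q (k j) s) (F s)); last exact: F_continuous.
    by apply: QY; rewrite as_ (le_trans st).
  have XPE : (fun j => P (k j) t) = (fun j => X (k j) t).
    by apply/funext => j; rewrite X_P.
  rewrite XPE in lim.
  exact: (cvg_unique (@norm_hausdorff _ _) (XY t atI) lim).
exists Y; split => //.
- by rewrite YE ?lexx ?lerDl//= vint_nil addr0.
- move=> t /andP[]; rewrite le_eqVlt => /predU1P[<- _|at_ ta].
    by rewrite YE ?lexx ?lerDl//= vint_nil addr0.
  have aI : a < t <= a + 1 by rewrite at_.
  apply: (closed_cvg (u_ := fun j => Q (k j) t) K K_closed _ (Y t) (QY t aI)).
  by exists 0%N => // j _; exact: (projP _).1.
- by split=> // i; exact: F_measurable.
Qed.

End Viability.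

(** * Time translation and essential bounds *)

Section TimeShift.
Context {R : realType}.
Local Notation mu := (@lebesgue_measure R).

Lemma ae_imply (P Q : R -> Prop) :
  {ae mu, forall t, P t} -> (forall t, P t -> Q t) -> {ae mu, forall t, Q t}.
Proof.
move=> [A [mA A0 PA]] PQ; exists A; split=> // t nQ; apply: PA => /PQ.
exact: nQ.
Qed.

Lemma measurable_shift (c : R) :
  measurable_fun setT (shift c : measurableTypeR R -> measurableTypeR R).
Proof. exact: measurable_funD. Qed.

(** Both measures agree on half-open intervals. *)
Lemma lebesgue_measure_shift (c : R) (A : set R) : measurable A ->
  mu (shift c @^-1` A) = mu A.
Proof.
move=> mA.
suff : pushforward mu (shift c : measurableTypeR R -> measurableTypeR R) A = mu A by [].
apply/esym/lebesgue_measure_unique => //=; first exact: measurable_shift.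
move=> _ _ [[a b]] _ <-; rewrite /pushforward.
rewrite (_ : shift c @^-1` _ = `]a - c, b - c]%classic).
  rewrite /= !lebesgue_measure_itv/= !lte_fin ltrD2r.
  by case: ifP => // _; congr (_%:E); ring.
by apply/seteqP; split=> t; rewrite /shift/= !in_itv/= ltrBlDr lerBrDr.
Qed.

Lemma ae_shift (c : R) (P : R -> Prop) :
  {ae mu, forall t, P t} -> {ae mu, forall t, P (t + c)}.
Proof.
move=> [A [mA A0 PA]]; exists (shift c @^-1` A); split.
- by rewrite -[_ @^-1` _]setTI; exact: measurable_shift.
- by rewrite lebesgue_measure_shift.
- by move=> t /= nP; apply: PA.
Qed.

Lemma lebesgue_measureT_gt0 : (0 < mu [set: R])%E.
Proof.
apply: (@lt_le_trans _ _ (mu `[0, 1])).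
  by rewrite lebesgue_measure_itv/= lte_fin ltr01 oppr0 adde0 lte_fin.
by apply: le_measure; rewrite ?inE.
Qed.

Lemma LinftyP k (q : R -> 'cV[R]_k) : Linfty q <->
  (forall j, measurable_fun setT (fun t => q t j 0)) /\
  exists C : R, {ae mu, forall t, eucl (q t) <= C}.
Proof.
rewrite /Linfty /finite_norm unlock lebesgue_measureT_gt0.
split=> -[mq fq]; split=> //; last first.
  have [C qC] := fq; apply: (@le_lt_trans _ _ C%:E); last exact: ltry.
  apply/ess_supP; apply: (ae_imply qC) => t {}qC.
  by rewrite /= lee_fin ger0_norm// sqrtr_ge0.
have h := @ess_sup_ge _ _ _ mu (abse \o (EFin \o (fun t => eucl (q t)))).
case: (ess_sup _ _) fq h => [C _ h|//|_ h]; [exists C|exists 0];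
  apply: (ae_imply h) => t //=.
by rewrite lee_fin; apply: le_trans; exact: ler_norm.
Qed.

Lemma Linfty_shift k (q : R -> 'cV[R]_k) c : Linfty q ->
  Linfty (fun t => q (t + c)).
Proof.
move=> /LinftyP[mq [C qC]]; apply/LinftyP; split.
  by move=> j; apply: (measurableT_comp (mq j)); exact: measurable_shift.
by exists C; exact: (ae_shift c qC).
Qed.

Lemma Linfty_norm_ge k (q : R -> 'cV[R]_k) t0 t : Linfty q ->
  {ae mu, forall s, t0 < s -> s < t -> eucl (q s) <= Linfty_norm q t0 t}.
Proof.
move=> /LinftyP[_ [C qC]]; rewrite /Linfty_norm unlock lebesgue_measureT_gt0.
set g := _ \_ _.
have gE s : t0 < s -> s < t -> g s = (eucl (q s))%:E.
  by move=> t0s st; rewrite /g patchE mem_set//= in_itv/= t0s st.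
have gC : (ess_sup mu (abse \o g) <= `|C|%:E)%E.
  apply/ess_supP; apply: (ae_imply qC) => s {}qC.
  rewrite /= /g patchE; case: ifP => _ /=; last by rewrite normr0 lee_fin.
  by rewrite lee_fin ger0_norm ?sqrtr_ge0// (le_trans qC)// ler_norm.
have h := @ess_sup_ge _ _ _ mu (abse \o g).
case: (ess_sup _ _) gC h => [D _ h|//|_ h]; apply: (ae_imply h) => s + t0s st;
  rewrite /= gE//= lee_fin.
by apply: le_trans; exact: ler_norm.
Qed.

Lemma Linfty_norm_ge0 k (q : R -> 'cV[R]_k) t0 t : 0 <= Linfty_norm q t0 t.
Proof. by rewrite /Linfty_norm fine_ge0// Lnorm_ge0. Qed.

Lemma absolutely_continuous_lipschitz n (x : R -> 'cV[R]_n) a b M :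
  0 <= M ->
  (forall s t, a <= s -> s <= t -> t <= b -> `|x t - x s| <= M * (t - s)) ->
  absolutely_continuous a b x.
Proof.
move=> M0 xM e e0; have M10 : 0 < M + 1 by rewrite ltr_wpDl.
exists (e / (M + 1)); first exact: divr_gt0.
move=> m u v uv _; rewrite ltr_pdivlMr// => uve.
apply: le_lt_trans uve; rewrite mulr_suml; apply: ler_sum => i _.
have [au [uvi vb]] := uv i.
apply: le_trans (xM _ _ au uvi vb) _.
by rewrite mulrC ler_wpM2l ?subr_ge0// lerDl.
Qed.

(** This moves a later time to [t0], the only initial time at which uniqueness
    is assumed. *)
Lemma is_solution_shift n k (f : 'cV[R]_n -> 'cV[R]_k -> 'cV[R]_n) q t0 x0 x c :
  0 <= c -> is_solution f q t0 x0 +oo x ->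
  is_solution f (fun t => q (t + c)) t0 (x (t0 + c)) +oo (fun t => x (t + c)).
Proof.
move=> c0 [_ x_0 acx dx]; split=> //.
- by rewrite ltry.
- move=> b t0b _ e e0.
  have t0bc : t0 <= b + c by rewrite (le_trans t0b)// lerDl.
  have [d d0 dP] := acx (b + c) t0bc (ltry _) e e0.
  exists d => // m u v uv tri uvd.
  apply: (dP m (fun i => u i + c) (fun i => v i + c)).
  + move=> i; have [au [uvi vb]] := uv i; rewrite !lerD2r; split=> //.
    by rewrite (le_trans au)// lerDl.
  + apply/trivIsetP => i j _ _ ij; apply/seteqP; split=> // t /=.
    rewrite !in_itv/= => -[/andP[t1 t2] /andP[t3 t4]].
    have /trivIsetP/(_ i j I I ij)/seteqP[+ _] := tri.
    move=> /(_ (t - c)); apply=> /=.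
    by rewrite !in_itv/= !ltrBrDr !ltrBlDr t1 t2 t3 t4.
  + rewrite (eq_bigr (fun i => v i - u i))// => i _; ring.
- apply: (ae_imply (ae_shift c dx)) => t h t0t _.
  have {h} : is_derive (t + c) 1 x (f (x (t + c)) (q (t + c))).
    by apply: h; rewrite ?ltry// (lt_le_trans t0t)// lerDl.
  have E : (fun h : R => h^-1 *:
        (((fun r => x (r + c)) \o shift t) (h *: (1 : R)) - x (t + c))) =
      (fun h : R => h^-1 *: ((x \o shift (t + c)) (h *: (1 : R)) - x (t + c))).
    by apply/funext => h; rewrite /shift /= addrA.
  move=> [dx1 dx2]; split; first by rewrite /derivable E.
  by rewrite /derive E.
Qed.

End TimeShift.

(** * Local viability and forward invariance *)

Section Cutoff.
Context {R : realType} {n : nat}.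

(** Multiplying the field by a nonnegative scalar keeps the proximal
    inequality, whereas composing it with a retraction onto a ball would not. *)
Definition cutoff (x0 x : 'cV[R]_n) : R := Num.max 0 (Num.min 1 (2 - `|x - x0|)).

Lemma cutoff_ge0 x0 x : 0 <= cutoff x0 x.
Proof. by rewrite le_max lexx. Qed.

Lemma cutoff_le1 x0 x : cutoff x0 x <= 1.
Proof. by rewrite ge_max ler01 ge_min lexx. Qed.

Lemma cutoff1 x0 x : `|x - x0| <= 1 -> cutoff x0 x = 1.
Proof. by move=> xx0; rewrite /cutoff min_l ?max_r//; lra. Qed.

Lemma cutoff0 x0 x : 2 <= `|x - x0| -> cutoff x0 x = 0.
Proof. by move=> xx0; rewrite /cutoff max_l// ge_min; apply/orP; right; lra. Qed.

Lemma cutoff_continuous x0 : continuous (cutoff x0).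
Proof.
apply: (@lipschitz_continuous _ 'cV[R]_n R^o _ 1) => x y; rewrite mul1r.
have xy : `| `|x - x0| - `|y - x0| | <= `|x - y|.
  by apply: le_trans (ler_dist_dist _ _) _; rewrite opprB addrA subrK.
move: xy; rewrite ler_norml => /andP[xy yx].
rewrite /cutoff ler_norml.
case: (leP 1 (2 - `|x - x0|)) => ?; case: (leP 1 (2 - `|y - x0|)) => ?;
  rewrite ?(max_r ler01);
  try case: (leP 0 (2 - `|x - x0|)) => ?; try case: (leP 0 (2 - `|y - x0|)) => ?;
  by apply/andP; split; lra.
Qed.

End Cutoff.

Section LocalViability.
Context {R : realType} {n k : nat}.
Local Notation mu := (@lebesgue_measure R).
Variables (f : 'cV[R]_n -> 'cV[R]_k -> 'cV[R]_n).
Hypothesis hf : continuous (fun z : 'cV[R]_n * 'cV[R]_k => f z.1 z.2).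
Variables (K : set 'cV[R]_n) (c : R).
Hypothesis K_closed : closed K.
Hypothesis K_tangent :
  forall x v, K x -> eucl v <= c -> bouligand K x (f x v).

Lemma field_bounded r : exists2 M, 0 <= M &
  forall x v, `|x| <= r -> `|v| <= c -> `|f x v| <= M.
Proof.
have cball m (B : R) : compact [set x : 'cV[R]_m | `|x| <= B].
  apply: (@closed_bounded_compact _ _ _ B) => //.
  apply: (closed_comp (f := fun x : 'cV[R]_m => `|x|) (D := [set z | z <= B])).
    by move=> x _; exact: norm_continuous.
  exact: closed_le.
have : compact [set f z.1 z.2 | z in [set x | `|x| <= r] `*` [set v | `|v| <= c]].
  apply: (continuous_compact (f := fun z : 'cV[R]_n * 'cV[R]_k => f z.1 z.2)).
    exact: continuous_subspaceT.
  exact: compact_setX.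
move=> /compact_bounded/ex_strict_bound_gt0[M M0 bM].
exists M; first exact: ltW.
by move=> x v xr vc; apply/ltW/bM; exists (x, v).
Qed.

Variables (q : R -> 'cV[R]_k).
Hypothesis q_measurable : forall j, measurable_fun setT (fun t => q t j 0).

(** The cut on the input makes the field bounded also at the times where the
    input exceeds its essential bound; the value zero put there satisfies the
    proximal inequality. *)
Definition cutoff_field (x0 : 'cV[R]_n) (s : R) (x : 'cV[R]_n) : 'cV[R]_n :=
  if eucl (q s) <= c then cutoff x0 x *: f x (q s) else 0.

(** Where the input is admissible, the field is a continuous function of the
    stacked vector of [y s] and [q s]. *)
Lemma cutoff_field_measurable x0 (y : R -> 'cV[R]_n) :
  (forall i, measurable_fun setT (fun s => y s i 0)) ->
  forall i, measurable_fun setT (fun s => cutoff_field x0 s (y s) i 0).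
Proof.
move=> my i.
pose g (w : 'cV[R]_(n + k)) : R :=
  cutoff x0 (usubmx w) * f (usubmx w) (dsubmx w) i 0.
have cu : continuous (@usubmx R n k 1).
  apply: (@lipschitz_continuous _ _ _ _ 1) => a b; rewrite mul1r -linearB.
  by apply: norm_le_coord => // i' j; rewrite mxE coord_le_norm.
have cd : continuous (@dsubmx R n k 1).
  apply: (@lipschitz_continuous _ _ _ _ 1) => a b; rewrite mul1r -linearB.
  by apply: norm_le_coord => // i' j; rewrite mxE coord_le_norm.
have cg : continuous g.
  have cc : continuous (fun w : 'cV[R]_(n + k) => cutoff x0 (usubmx w)).
    move=> w; apply: (@continuous_comp 'cV[R]_(n + k) 'cV[R]_n R); first exact: cu.
    exact: cutoff_continuous.
  have cf : continuous (fun w : 'cV[R]_(n + k) => f (usubmx w) (dsubmx w) i 0).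
    move=> w; apply: (@continuous_comp 'cV[R]_(n + k) 'cV[R]_n R
      (fun w => f (usubmx w) (dsubmx w)) (fun z => z i 0));
      last exact: coord_continuous.
    apply: (@continuous_comp 'cV[R]_(n + k) ('cV[R]_n * 'cV[R]_k)%type 'cV[R]_n
      (fun w => (usubmx w, dsubmx w)) (fun z => f z.1 z.2)); last exact: hf.
    exact: (cvg_pair (cu w) (cd w)).
  by move=> w; exact: (cvgM (cc w) (cf w)).
have -> : (fun s => cutoff_field x0 s (y s) i 0) =
    (fun s => if eucl (q s) <= c then (g \o (fun s => col_mx (y s) (q s))) s else 0).
  apply/funext => s; rewrite /cutoff_field /g /=; case: ifP => _; last by rewrite mxE.
  by rewrite col_mxKu col_mxKd mxE.
apply: measurable_fun_ifT => //.
  apply: (measurable_fun_ler (f := fun s => eucl (q s)) (g := fun=> c)) => //.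
  exact: (measurable_comp_continuous (@eucl_continuous R k) q_measurable).
apply: measurable_comp_continuous => // j.
case: (splitP j) => j' jj'.
  rewrite (_ : j = lshift k j'); last exact/val_inj.
  by under eq_fun do rewrite col_mxEu; exact: my.
rewrite (_ : j = rshift n j'); last exact/val_inj.
by under eq_fun do rewrite col_mxEd; exact: q_measurable.
Qed.

(** The cut field is bounded and has a viable solution on [[t0, t0 + 1]]. For a
    short time this solution is within distance 1 of [x0], where nothing has
    been cut. *)
Lemma local_viable_solution t0 T x0 : K x0 -> t0 < T ->
  {ae mu, forall s, t0 < s -> s < T -> eucl (q s) <= c} ->
  exists d y, [/\ 0 < d, is_solution f q t0 x0 (t0 + d)%:E y &
    forall t, t0 <= t -> t <= t0 + d -> K (y t)].
Proof.
move=> Kx0 t0T qc.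
have [M M0 fM] := field_bounded (`|x0| + 2).
have fieldM s x : `|cutoff_field x0 s x| <= M.
  rewrite /cutoff_field; case: ifP => qs; last by rewrite normr0.
  have [xx0|/ltW xx0] := leP 2 `|x - x0|; first by rewrite cutoff0// scale0r normr0.
  rewrite normrZ ger0_norm ?cutoff_ge0//.
  apply: (@le_trans _ _ (1 * M)); last by rewrite mul1r.
  rewrite ler_pM ?cutoff_ge0 ?cutoff_le1// fM//.
    have -> : x = x0 + (x - x0) by rewrite addrC subrK.
    by rewrite (le_trans (ler_normD _ _))// lerD2l.
  exact: le_trans (norm_le_eucl _) qs.
have fieldc s : continuous (cutoff_field x0 s).
  have [qs|/negbTE qs] := boolP (eucl (q s) <= c); last first.
    rewrite (_ : cutoff_field x0 s = cst 0); first exact: cst_continuous.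
    by apply/funext => x; rewrite /cutoff_field qs.
  rewrite (_ : cutoff_field x0 s = fun x => cutoff x0 x *: f x (q s)); last first.
    by apply/funext => x; rewrite /cutoff_field qs.
  have cfq : continuous (fun x => f x (q s)).
    move=> x; apply: (@continuous_comp 'cV[R]_n ('cV[R]_n * 'cV[R]_k)%type 'cV[R]_n
      (fun x => (x, q s)) (fun z => f z.1 z.2)); last exact: hf.
    have cx : continuous (fun x : 'cV[R]_n => x) by move=> z; exact: cvg_id.
    have cq : continuous (fun _ : 'cV[R]_n => q s) by exact: cst_continuous.
    exact: (cvg_pair (cx x) (cq x)).
  by move=> x; exact: (cvgZ (@cutoff_continuous R n x0 x) (cfq x)).
have fieldn s x p : nearest_point K x p -> dotp (x - p) (cutoff_field x0 s p) <= 0.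
  move=> xp; rewrite /cutoff_field; case: ifP => qs; last first.
    by rewrite -(scale0r 0) dotpZr mul0r.
  rewrite dotpZr mulr_ge0_le0 ?cutoff_ge0//.
  exact: (bouligand_nearest (K_tangent xp.1 qs) xp).
have [y [ya yK bu yE]] :=
  viable_solution t0 (@cutoff_field_measurable x0) fieldc fieldM fieldn K_closed Kx0.
set u := (fun s => cutoff_field x0 s (y s)) in bu yE.
pose z t := x0 + vint u t0 t.
have zB s t : t0 <= s -> s <= t -> `|z t - z s| <= M * (t - s).
  move=> t0s st.
  rewrite /z (vint_cat bu t0s st) [x0 + (_ + _)]addrA [_ - _]addrC addKr.
  exact: norm_vint_le.
have zt0 : z t0 = x0 by rewrite /z vint_nil addr0.
(* The curve moves at speed at most [M]; up to time [T] the input bound holds. *)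
pose d := Num.min (T - t0) (M + 1)^-1.
have M10 : 0 < M + 1 by rewrite ltr_wpDl.
have d0 : 0 < d by rewrite lt_min subr_gt0 t0T invr_gt0.
have dM : (M + 1) * d <= 1 by rewrite -ler_pdivlMl// mulr1 /d ge_min lexx orbT.
have d1 : d <= 1 by nra.
have dT : t0 + d <= T by rewrite -lerBrDl /d ge_min lexx.
have zE t : t0 <= t -> t <= t0 + d -> z t = y t.
  by move=> t1 t2; rewrite yE// t1/=; lra.
exists d, z; split=> //.
  split=> //.
  - by rewrite lte_fin ltrDl.
  - move=> b _ _; apply: (absolutely_continuous_lipschitz M0) => s t t0s st _.
    exact: zB.
  - have dv := vint_is_derive t0 bu.
    have qdv : {ae mu, forall t, (t0 < t -> t < T -> eucl (q t) <= c) /\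
        (t0 < t -> is_derive t 1 (vint u t0) (u t))}.
      by apply: filterI => //; exact: (ae_filter_ringOfSetsType mu).
    apply: (ae_imply qdv) => t [qt du] t0t; rewrite lte_fin => td.
    have qtc : eucl (q t) <= c by apply: qt => //; lra.
    have zx0 : `|z t - x0| <= 1.
      have := zB t0 t (lexx _) (ltW t0t); rewrite zt0 => /le_trans; apply; nra.
    have -> : f (z t) (q t) = 0 + u t.
      rewrite add0r /u -zE ?(ltW t0t) ?(ltW td)//.
      by rewrite /cutoff_field qtc (cutoff1 zx0) scale1r.
    have dut := du t0t.
    exact: is_deriveD.
by move=> t t1 t2; rewrite zE//; apply: yK; rewrite t1/=; lra.
Qed.

End LocalViability.

Section Invariance.
Context {R : realType} {n k : nat}.
Local Notation mu := (@lebesgue_measure R).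

Lemma absolutely_continuous_dist (x : R -> 'cV[R]_n) a b e :
  absolutely_continuous a b x -> 0 < e ->
  exists2 d, 0 < d & forall s t, a <= s -> s <= t -> t <= b -> t - s < d ->
    `|x t - x s| < e.
Proof.
move=> acx e0; have [d d0 dP] := acx e e0; exists d => // s t as_ st tb tsd.
have := dP 1%N (fun=> s) (fun=> t); rewrite !big_ord1; apply=> //.
by apply/trivIsetP => i j _ _; rewrite (ord1 i) (ord1 j) eqxx.
Qed.

Variables (f : 'cV[R]_n -> 'cV[R]_k -> 'cV[R]_n) (K S : set 'cV[R]_n) (t0 c : R).
Hypothesis hf : continuous (fun z : 'cV[R]_n * 'cV[R]_k => f z.1 z.2).
Hypothesis K_closed : closed K.
Hypothesis K_tangent :
  forall x v, K x -> eucl v <= c -> bouligand K x (f x v).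
Hypothesis sub_interior : interior S `<=` interior K.
Hypothesis hunique : forall q x0, Linfty q -> ~ interior S x0 ->
  locally_forward_unique f q t0 x0.

(** Let [tau] be the last time up to which [x] is in [K]. If [x tau] is
    interior to [K], continuity carries [x] further; otherwise uniqueness at
    [x tau] identifies [x] with a viable solution, which carries it further
    too. *)
Lemma forward_invariant q x0 x T : K x0 -> Linfty q ->
  is_solution f q t0 x0 +oo x -> t0 <= T ->
  {ae mu, forall s, t0 < s -> s < T -> eucl (q s) <= c} ->
  K (x T).
Proof.
move=> Kx0 Lq solx t0T qc; apply: contrapT => nKT.
have [_ x_0 acx _] := solx.
pose I := [set t | t0 <= t <= T /\ forall s, t0 <= s -> s <= t -> K (x s)].
have It0 : I t0.
  split; first by rewrite lexx.
  by move=> s t0s st0; rewrite (_ : s = t0) ?x_0//; apply/eqP; rewrite eq_le st0.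
have ubI : ubound I T by move=> t [/andP[]].
have supI : has_sup I by split; [exists t0|exists T].
set tau := sup I.
have t0tau : t0 <= tau by apply: ub_le_sup It0; exists T.
have tauT : tau <= T by apply: ge_sup; [exists t0|].
have Kbefore s : t0 <= s -> s < tau -> K (x s).
  by move=> t0s /(sup_gt (ex_intro _ t0 It0))[t [_ Kt] /ltW st]; exact: Kt.
have xdist e : 0 < e -> exists2 d, 0 < d & forall s t, t0 <= s -> s <= t ->
    t <= T + 1 -> t - s < d -> `|x t - x s| < e.
  by apply: absolutely_continuous_dist; apply: acx; rewrite ?ltry//; lra.
have Ktau : K (x tau).
  have [tau0|tau0] := eqVneq tau t0; first by rewrite tau0 x_0.
  have t0_tau : t0 < tau by rewrite lt_neqAle eq_sym tau0.
  apply: K_closed => U /nbhs_normP[e /= e0 eU].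
  have [d d0 dP] := xdist e e0.
  pose s := Num.max t0 (tau - d / 2).
  have stau : s < tau by rewrite gt_max t0_tau/=; lra.
  have t0s : t0 <= s by rewrite le_max lexx.
  have sd : tau - d / 2 <= s by rewrite le_max lexx orbT.
  exists (x s); split; first exact: Kbefore.
  by apply: eU; apply: dP => //; [exact: ltW|lra|lra].
have {nKT} tau_T : tau < T.
  rewrite lt_neqAle tauT andbT; apply/eqP => tauE.
  by apply: nKT; rewrite -tauE.
suff [rho rho0 Kafter] : exists2 rho, 0 < rho &
    forall t, tau < t -> t < tau + rho -> K (x t).
  pose t := tau + Num.min (rho / 2) (T - tau).
  have m0 : 0 < Num.min (rho / 2) (T - tau) by rewrite lt_min divr_gt0// subr_gt0.
  have tT : t <= T by rewrite /t -lerBrDl ge_min lexx orbT.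
  have trho : t < tau + rho.
    by rewrite /t ltrD2l gt_min; apply/orP; left; lra.
  have : t <= tau.
    apply: ub_le_sup; first by exists T.
    split; first by rewrite tT andbT (le_trans t0tau)// /t lerDl ltW.
    move=> s t0s st; have [stau|taus|->//] := ltgtP s tau; first exact: Kbefore.
    by apply: Kafter => //; exact: le_lt_trans st trho.
  by rewrite /t gerDl leNgt m0.
have [|niK] := pselect (interior K (x tau)).
  move=> /nbhs_normP[e /= e0 eK]; have [d d0 dP] := xdist e e0.
  exists (Num.min d 1); first by rewrite lt_min d0 ltr01.
  move=> t taut; rewrite -ltrBlDl lt_min => /andP[td t1].
  by apply: eK; rewrite /ball_/= distrC; apply: dP => //; [exact: ltW|lra].
pose c0 := tau - t0.
have c00 : 0 <= c0 by rewrite subr_ge0.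
have tauE : t0 + c0 = tau by rewrite /c0 addrC subrK.
pose q' t := q (t + c0).
have Lq' : Linfty q' := Linfty_shift c0 Lq.
have solx' := is_solution_shift c00 solx.
rewrite tauE -/q' in solx'.
have q'c : {ae mu, forall s, t0 < s -> s < T - c0 -> eucl (q' s) <= c}.
  apply: (ae_imply (ae_shift c0 qc)) => s h t0s sT; apply: h; lra.
have t0Tc : t0 < T - c0 by rewrite /c0; lra.
have [d [y [d0 soly Ky]]] :=
  local_viable_solution hf K_closed K_tangent (proj1 Lq') Ktau t0Tc q'c.
have niS : ~ interior S (x tau) by move=> /sub_interior.
have : \forall t \near t0^'+, x (t + c0) = y t.
  exact: (hunique Lq' niS solx' soly).
move=> [rho /= rho0 rhoP].
exists (Num.min rho d); first by rewrite lt_min rho0.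
move=> t taut; rewrite -ltrBlDl lt_min => /andP[trho td].
have -> : x t = y (t - c0).
  rewrite -rhoP ?subrK//=; last by rewrite /c0; lra.
  by rewrite ltr0_norm /c0; lra.
by apply: Ky; rewrite /c0; lra.
Qed.

End Invariance.

(** * Dilations *)

Section Dilations.
Context {R : realType} {n : nat}.
Variables (N : 'cV[R]_n -> R) (G : 'M[R]_n).
Hypothesis hN : is_norm N.
Hypothesis hGm : monotone_dilation N G.

(** A nonzero [x] has [N (d(s) x) > N (d(s - 1) x) >= 0]. *)
Lemma dilation_unitmx s : expmx (s *: G) \in unitmx.
Proof.
apply: mulmx_inj_unit => x Gx0; apply: contrapT => /eqP x0.
have := @hGm x x0 (s - 1) s; rewrite ltrBlDr ltrDl => /(_ ltr01).
by rewrite {2}/dilation Gx0 is_norm0// ltNge is_norm_ge0.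
Qed.

Lemma dilationK s x : dilation G s (invmx (expmx (s *: G)) *m x) = x.
Proof. by rewrite /dilation mulKVmx// dilation_unitmx. Qed.

Lemma dilation_norm_homo x s t : s <= t ->
  N (dilation G s x) <= N (dilation G t x).
Proof.
have [->|x0] := eqVneq x 0; first by rewrite /dilation !mulmx0.
by rewrite le_eqVlt => /predU1P[->//|st]; apply/ltW/hGm.
Qed.

Definition dilated_ball s c := forall x, eucl x <= c ->
  exists2 y, N y <= 1 & dilation G s y = x.

Lemma dilated_ball_small s : exists2 c, 0 < c & dilated_ball s c.
Proof.
have [C C0 NC] := is_norm_le hN.
pose B := invmx (expmx (s *: G)).
pose L := C * (n%:R * `|B|) + 1.
have L0 : 0 < L by rewrite ltr_wpDl// !mulr_ge0// ltW.
exists L^-1; first by rewrite invr_gt0.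
move=> x xL; exists (B *m x); last exact: dilationK.
rewrite (le_trans (NC _))//.
apply: (@le_trans _ _ (C * (n%:R * `|B|) * `|x|)).
  by rewrite -[leRHS]mulrA ler_wpM2l ?(ltW C0)// normM_mulmx.
apply: (@le_trans _ _ (L * `|x|)); first by rewrite ler_wpM2r// lerDl.
by rewrite -ler_pdivlMl// mulr1 (le_trans (norm_le_eucl _)).
Qed.

Hypothesis hG : is_dilation N G.

(** Dini's argument: monotonicity in [s] makes divergence at a point persist
    nearby and for all larger [s], and compactness of the unit sphere makes it
    uniform. *)
Lemma dilation_unbounded (L : R) : 0 <= L ->
  exists s, forall x, `|x| = 1 -> L <= N (dilation G s x).
Proof.
move=> L0.
have Nd s : continuous (fun x => N (dilation G s x)).
  move=> x; apply: (@continuous_comp 'cV[R]_n 'cV[R]_n R);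
    first exact: mulmx_continuous.
  exact: is_norm_continuous.
have := @unit_sphere_compact R n; rewrite compact_near_coveringP.
move=> /(_ nat \oo (fun j x => L < N (dilation G j%:R x)) _).
case=> [x /= x1|j0 _ j0P].
  have x0 : x != 0 by rewrite -normr_gt0 x1.
  have [+ _] := hG x0; rewrite limf_einfE => supy.
  have : (L%:E < ereal_sup
      [set ereal_inf ((fun s => (N (dilation G s x))%:E) @` V) | V in +oo%R])%E.
    by rewrite supy ltry.
  move=> /ereal_sup_gt[_ [V [A [_ AV]] <-] LV].
  pose j := (Num.bound `|A|).
  have Aj : A < j%:R by rewrite (le_lt_trans (ler_norm _))// archi_boundP.
  have Lj : L < N (dilation G j%:R x).
    rewrite -lte_fin (lt_le_trans LV)//; apply: ereal_inf_lbound.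
    by exists j%:R => //; exact: AV.
  exists ([set y | L < N (dilation G j%:R y)], [set i | (j <= i)%N]).
    split => /=; last by exists j.
    by have := Nd j%:R x; move=> /(_ [set z | L < z]); apply; exact: lt_nbhsr.
  move=> [y i] /= [Ly ji]; apply: lt_le_trans Ly _.
  by apply: dilation_norm_homo; rewrite ler_nat.
exists j0%:R => x x1; apply/ltW.
by apply: j0P => /=.
Qed.

(** A preimage [y] of [x] has [N x = |y| N (d(s) (y / |y|))], so a large lower
    bound for [d(s)] on the unit sphere forces [y] to be small. *)
Lemma dilated_ball_large c : 0 <= c -> exists s, dilated_ball s c.
Proof.
move=> c0; have [C C0 NC] := is_norm_le hN.
have CcC0 : 0 <= C * c * C by rewrite !mulr_ge0// ltW.
(* [N x <= C c] and [N y <= C |y|], hence [N y <= C * (C c) / L] where [L] is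
   the lower bound on the sphere. *)
have [|s sP] := @dilation_unbounded (C * c * C + 1); first by rewrite addr_ge0.
exists s => x xc; pose y := invmx (expmx (s *: G)) *m x.
exists y; last exact: dilationK.
have [y0|yN0] := eqVneq y 0; first by rewrite y0 is_norm0.
have ny0 : 0 < `|y| by rewrite normr_gt0.
have : C * c * C + 1 <= N (dilation G s (`|y|^-1 *: y)).
  by apply: sP; rewrite normrZ normfV normr_id mulVf// gt_eqF.
have [_ NZ _] := hN.
rewrite {1}/dilation -scalemxAr NZ normfV normr_id -/(dilation G s y) dilationK.
rewrite ler_pdivlMl// => h.
have Nx : N x <= C * c.
  by rewrite (le_trans (NC _))// ler_wpM2l ?(ltW C0)// (le_trans (norm_le_eucl _)).
have CC : C * (C * c * C + 1) * `|y| <= C * (C * c).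
  by rewrite -mulrA ler_wpM2l ?(ltW C0)// mulrC (le_trans h).
have Ny := NC y; nra.
Qed.

End Dilations.

(** * Dilated sublevel sets *)

Section ScaledSets.
Context {R : realType} {n p : nat}.
Variables (N : 'cV[R]_n -> R) (G : 'M[R]_n).
Hypothesis hN : is_norm N.
Hypothesis hGm : monotone_dilation N G.
Variables (phi : 'I_p -> 'cV[R]_n -> R) (nu r : 'I_p -> R).
Hypothesis hphi : forall i, continuous (phi i).
Hypothesis hphihom : forall i, homogeneous G (nu i) (phi i).
Hypothesis r_ge0 : forall i, 0 <= r i.

Definition scaled_set s := enlarged_safe_set phi nu (fun i => expR s * r i).

Lemma scaled_powR s i : (expR s * r i) `^ nu i = expR (nu i * s) * r i `^ nu i.
Proof. by rewrite powRM ?expR_ge0// -expRM (mulrC s). Qed.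

Lemma scaled_set_closed s : closed (scaled_set s).
Proof.
rewrite (_ : scaled_set s = \bigcap_(i in [set: 'I_p])
    [set x | 0 <= phi i x + (expR s * r i) `^ nu i]); last first.
  by apply/seteqP; split=> x /= h i; [move=> _|]; exact: h.
apply: closed_bigI => i _.
apply: (closed_comp (f := fun x => phi i x + (expR s * r i) `^ nu i)
  (D := [set z | 0 <= z])); last exact: closed_ge.
by move=> x _; exact: (cvgD (@hphi i x) (cvg_cst _)).
Qed.

Lemma safe_scaled_set s x : safe_set phi x -> scaled_set s x.
Proof. by move=> h i; rewrite addr_ge0 ?powR_ge0//; exact: h. Qed.

(** Both sides of the inequality that defines the set scale by
    [expR (nu i * s)]. *)
Lemma scaled_setP s x :
  scaled_set s (dilation G s x) <-> enlarged_safe_set phi nu r x.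
Proof.
suff E i : (0 <= phi i (dilation G s x) + (expR s * r i) `^ nu i) =
           (0 <= phi i x + r i `^ nu i).
  by split=> h i; have := h i; rewrite E.
by rewrite hphihom scaled_powR -mulrDr pmulr_rge0// expR_gt0.
Qed.

Context {k : nat}.
Variables (Nk : 'cV[R]_k -> R) (Gq : 'M[R]_k).
Variables (f : 'cV[R]_n -> 'cV[R]_k -> 'cV[R]_n) (mu : R).
Hypothesis hfhom : forall s x q,
  f (dilation G s x) (dilation Gq s q) = expR (mu * s) *: dilation G s (f x q).
Hypothesis htangent : forall x q,
  boundary (enlarged_safe_set phi nu r) x -> Nk q <= 1 ->
  tangent_cone N (enlarged_safe_set phi nu r) x (f x q).

(** The point is pulled back to the undilated set, where it is either interior
    or on the boundary; the linear map [d(s)] and the positive factor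
    [expR (mu * s)] preserve the cone. *)
Lemma scaled_set_bouligand s x q : scaled_set s x -> Nk q <= 1 ->
  bouligand (scaled_set s) x (f x (dilation Gq s q)).
Proof.
move=> Ksx q1; set y := invmx (expmx (s *: G)) *m x.
have xE : x = dilation G s y by rewrite /y (dilationK hN).
rewrite xE in Ksx *; move/scaled_setP : Ksx => Ky.
rewrite hfhom; apply: bouligandZ; first exact: expR_gt0.
apply: (@bouligandS _ _ [set dilation G s z | z in enlarged_safe_set phi nu r]).
  by move=> _ [z Kz <-]; apply/scaled_setP.
apply: bouligand_mulmx.
have [iy|niy] := pselect (interior (enlarged_safe_set phi nu r) y).
  exact: interior_bouligand.
apply: (tangent_cone_bouligand hN); first by exists y.
by apply: htangent => //; split => //; exact: subset_closure.
Qed.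

End ScaledSets.

(** * Class K gains *)

Section ClassKMajorant.
Context {R : realType}.
Variable theta : R -> R.
Hypothesis theta_ge0 : forall c, 0 <= c -> 0 <= theta c.
Hypothesis theta_le : forall b c, 0 <= b -> b <= c -> theta b <= theta c.
Hypothesis theta_small : forall e, 0 < e -> exists2 d, 0 < d & theta d <= e.

Let ramp (u : R) := Num.max 0 (Num.min 1 (2 * u - 1)).

Let rampP u : [\/ u <= 1 / 2 /\ ramp u = 0,
  1 / 2 <= u <= 1 /\ ramp u = 2 * u - 1 | 1 <= u /\ ramp u = 1].
Proof.
rewrite /ramp; have [u1|/ltW u1] := lerP u (1 / 2).
  by apply: Or31; split=> //; apply: max_l; rewrite ge_min; apply/orP; right; lra.
have [u2|/ltW u2] := lerP u 1.
  by apply: Or32; split; [exact/andP|rewrite min_r ?max_r//; lra].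
by apply: Or33; split=> //; rewrite min_l ?max_r//; lra.
Qed.

Let ramp_itv u : 0 <= ramp u <= 1.
Proof. by case: (rampP u) => -[? ->]; lra. Qed.

Let terms c := [set theta b * ramp (c / b) | b in [set b : R | 0 < b]].

(** The ramp vanishes for [b >= 2 c] and equals one for [b <= c], so the
    supremum lies between [theta c] and [theta (2 * c)], and away from zero it
    is locally Lipschitz in [c]. The summand [c] makes it strictly increasing. *)
Definition majorant c := c + sup (terms c).

Let terms_le c b : 0 <= c -> 0 < b -> theta b * ramp (c / b) <= theta (2 * c).
Proof.
move=> c0 b0; have /andP[r0 r1] := ramp_itv (c / b).
have [bc|cb] := lerP b (2 * c).
  apply: (@le_trans _ _ (theta b)); first by rewrite ler_piMr// theta_ge0// ltW.
  by apply: theta_le => //; exact: ltW.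
rewrite (_ : ramp _ = 0) ?mulr0 ?theta_ge0 ?mulr_ge0//.
rewrite /ramp max_l// ge_min; apply/orP; right.
by rewrite subr_le0 mulrA ler_pdivrMr// mul1r ltW.
Qed.

Let has_sup_terms c : 0 <= c -> has_sup (terms c).
Proof.
move=> c0; split; first by exists (theta 1 * ramp (c / 1)); exists 1 => /=.
by exists (theta (2 * c)) => _ [b /= b0 <-]; exact: terms_le.
Qed.

Let sup_terms_le c : 0 <= c -> sup (terms c) <= theta (2 * c).
Proof.
move=> c0; apply: ge_sup; first exact: (has_sup_terms c0).1.
by move=> _ [b /= b0 <-]; exact: terms_le.
Qed.

Let terms_sup c b : 0 <= c -> 0 < b -> theta b * ramp (c / b) <= sup (terms c).
Proof.
by move=> c0 b0; apply: ub_le_sup; [exact: (has_sup_terms c0).2|exists b].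
Qed.

Let ramp_le u v : u <= v -> ramp u <= ramp v.
Proof.
by case: (rampP u) => -[? ->]; case: (rampP v) => -[? ->]; lra.
Qed.

Let sup_terms_homo b c : 0 <= b -> b <= c -> sup (terms b) <= sup (terms c).
Proof.
move=> b0 bc; have c0 := le_trans b0 bc.
apply: ge_sup; first exact: (has_sup_terms b0).1.
move=> _ [e /= e0 <-]; apply: le_trans (terms_sup c0 e0).
rewrite ler_wpM2l ?theta_ge0 ?(ltW e0)//; apply: ramp_le.
by rewrite ler_wpM2r// invr_ge0 ltW.
Qed.

Let sup_terms_lip c d : 0 < c -> c <= d ->
  sup (terms d) <= sup (terms c) + 2 * theta (2 * d) * (d - c) / c.
Proof.
move=> c0 cd; have d0 := le_trans (ltW c0) cd.
apply: ge_sup; first exact: (has_sup_terms d0).1.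
move=> _ [b /= b0 <-].
have inc : 0 <= 2 * theta (2 * d) * (d - c) / c.
  by rewrite !mulr_ge0 ?theta_ge0 ?subr_ge0 ?invr_ge0 ?mulr_ge0 ?(ltW c0).
(* For [b < c] the ramp is already one at [c / b]; for [b > 2 d] it is still
   zero at [d / b]; in between its slope in [c] is [2 / b], at most [2 / c]. *)
have [cb|bc] := lerP c b; last first.
  apply: (@le_trans _ _ (sup (terms c))); last by rewrite lerDl.
  apply: le_trans (terms_sup (ltW c0) b0).
  have -> : ramp (c / b) = 1.
    have : 1 <= c / b by rewrite ler_pdivlMr// mul1r ltW.
    by case: (rampP (c / b)) => -[? ->]; lra.
  rewrite mulr1 ler_piMr ?theta_ge0 ?(ltW b0)//.
  by case/andP: (ramp_itv (d / b)).
have [b2d|db] := lerP b (2 * d); last first.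
  rewrite (_ : ramp _ = 0) ?mulr0.
    rewrite addr_ge0//; apply: le_trans (terms_sup (ltW c0) b0).
    by rewrite mulr_ge0 ?theta_ge0 ?(ltW b0)//; case/andP: (ramp_itv (c / b)).
  rewrite /ramp max_l// ge_min; apply/orP; right.
  by rewrite subr_le0 mulrA ler_pdivrMr// mul1r ltW.
have rr : ramp (d / b) <= ramp (c / b) + 2 * ((d - c) / c).
  have step : d / b <= c / b + (d - c) / c.
    rewrite -lerBlDl -mulrBl ler_wpM2l ?subr_ge0// lef_pV2//.
  have dc0 : 0 <= (d - c) / c by rewrite divr_ge0 ?subr_ge0// ltW.
  by case: (rampP (d / b)) => -[? ->]; case: (rampP (c / b)) => -[? ->]; lra.
have tb : theta b <= theta (2 * d) by apply: theta_le => //; exact: ltW.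
have := terms_sup (ltW c0) b0; have tb0 := theta_ge0 (ltW b0).
have dc0 : 0 <= (d - c) / c by rewrite divr_ge0 ?subr_ge0// ltW.
rewrite -[2 * theta _ * _ / _]mulrA.
move: rr tb; set X := (d - c) / c in dc0 *; nra.
Qed.

Lemma majorant_class_K : class_K majorant.
Proof.
have sup0 : sup (terms 0) = 0.
  apply/eqP; rewrite eq_le; apply/andP; split.
    apply/ler_addgt0Pr => e e0; rewrite add0r.
    have [d d0 dle] := theta_small e0.
    apply: le_trans (sup_terms_le (lexx 0)) _; rewrite mulr0.
    exact: le_trans (theta_le (lexx 0) (ltW d0)) dle.
  apply: le_trans (terms_sup (lexx 0) ltr01); rewrite mulr_ge0 ?theta_ge0//.
  by case/andP: (ramp_itv (0 / 1)).
split; last by rewrite /majorant sup0 addr0.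
- apply/continuous_within_itvcyP; split.
    move=> c; rewrite in_itv/= andbT => c0.
    pose L := 4 * theta (4 * c) / c.
    have L0 : 0 <= L by rewrite !mulr_ge0 ?invr_ge0 ?theta_ge0 ?mulr_ge0// ltW.
    have lip x y : c / 2 <= x -> x <= y -> y <= 2 * c ->
        `|majorant x - majorant y| <= (1 + L) * (y - x).
      move=> cx xy yc; have x0 : 0 < x by apply: lt_le_trans cx; exact: divr_gt0.
      have := sup_terms_homo (ltW x0) xy.
      have : sup (terms y) <= sup (terms x) + L * (y - x).
        apply: le_trans (sup_terms_lip x0 xy) _; rewrite lerD2l.
        rewrite mulrAC ler_wpM2r ?subr_ge0// ler_pdivrMr//.
        apply: (@le_trans _ _ (2 * theta (4 * c))).
          by rewrite ler_wpM2l// theta_le ?mulr_ge0//; lra.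
        have -> : 2 * theta (4 * c) = L * (c / 2) by rewrite /L; field; rewrite gt_eqF.
        by rewrite ler_wpM2l.
      by rewrite /majorant ler_norml => ? ?; apply/andP; split; nra.
    apply/cvgrPdist_le => e e0.
    have c20 : 0 < c / 2 by exact: divr_gt0.
    have eL0 : 0 < e / (1 + L) by rewrite divr_gt0// ltr_wpDr.
    near=> x.
    have xe : `|c - x| <= e / (1 + L) by near: x; exact: cvgr_dist_le.
    have xc : `|c - x| <= c / 2 by near: x; exact: cvgr_dist_le.
    have {}xc : c / 2 <= x <= 2 * c by move: xc; rewrite ler_norml => /andP[*]; lra.
    case/andP: xc => cx xc.
    move: xe; rewrite ler_pdivlMr ?ltr_wpDr// mulrC => /(le_trans _); apply.
    have [xlec|/ltW clex] := lerP x c.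
      by rewrite distrC (le_trans (lip _ _ cx xlec _))//; lra.
    by rewrite (le_trans (lip _ _ _ clex xc))//; lra.
  have maj0 : majorant 0 = 0 by rewrite /majorant sup0 addr0.
  rewrite maj0; apply/cvgrPdist_le => e e0.
  have e20 : 0 < e / 2 by exact: divr_gt0.
  have [d d0 dle] := theta_small e20.
  have d20 : 0 < d / 2 by exact: divr_gt0.
  near=> x.
  have x0 : 0 < x by [].
  have xe : x <= e / 2 by near: x; exact: nbhs_right_le.
  have xd : x <= d / 2 by near: x; exact: nbhs_right_le.
  have sx := sup_terms_le (ltW x0).
  have tx : theta (2 * x) <= theta d by apply: theta_le; lra.
  have sx0 := sup_terms_homo (lexx 0) (ltW x0); rewrite sup0 in sx0.
  by rewrite sub0r normrN /majorant ger0_norm; lra.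
- move=> b c; rewrite !in_itv/= !andbT => b0 c0 bc.
  by rewrite /majorant ltr_leD// sup_terms_homo// ltW.
Unshelve. all: by end_near. Qed.

Lemma le_majorant c : 0 <= c -> theta c <= majorant c.
Proof.
rewrite le_eqVlt => /predU1P[<-|c0].
  have [_ _ ->] := majorant_class_K; apply/ler_addgt0Pr => e e0.
  have [d d0 dle] := theta_small e0.
  by rewrite add0r (le_trans _ dle)// theta_le// ltW.
have : theta c * ramp (c / c) <= sup (terms c) by apply: terms_sup => //; exact: ltW.
rewrite divff ?gt_eqF// (_ : ramp 1 = 1) ?mulr1.
  by move=> tc; rewrite /majorant (le_trans tc)// lerDr ltW.
by rewrite /ramp min_l ?max_r//; lra.
Qed.

End ClassKMajorant.

Section Gain.
Context {R : realType} {k : nat}.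
Variables (Nk : 'cV[R]_k -> R) (Gq : 'M[R]_k) (r nu : R).
Hypothesis hNk : is_norm Nk.
Hypothesis hGq : is_dilation Nk Gq.
Hypothesis hGqm : monotone_dilation Nk Gq.
Hypothesis nu_gt0 : 0 < nu.

Let depths c := [set (expR s * r) `^ nu | s in [set s | dilated_ball Nk Gq s c]].

(** The bounds obtained from all the dilated sets hold simultaneously, so their
    infimum is the gain that the argument yields at input size [c]. *)
Definition depth c := inf (depths c).

Let depths_ge0 c : lbound (depths c) 0.
Proof. by move=> _ [s _ <-]; exact: powR_ge0. Qed.

Let depths_neq0 c : 0 <= c -> depths c !=set0.
Proof.
move=> c0; have [s sP] := dilated_ball_large hNk hGqm hGq c0.
by exists ((expR s * r) `^ nu); exists s.
Qed.

Lemma depth_le c s : dilated_ball Nk Gq s c -> depth c <= (expR s * r) `^ nu.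
Proof. by move=> sP; apply: ge_inf; [exists 0; exact: depths_ge0|exists s]. Qed.

Lemma le_depth c y : 0 <= c ->
  (forall s, dilated_ball Nk Gq s c -> y <= (expR s * r) `^ nu) -> y <= depth c.
Proof.
by move=> c0 yP; apply: lb_le_inf; [exact: depths_neq0|move=> _ [s sP <-]; exact: yP].
Qed.

Lemma depth_ge0 c : 0 <= c -> 0 <= depth c.
Proof. by move=> c0; apply: le_depth => // s _; exact: powR_ge0. Qed.

Lemma depth_homo b c : 0 <= b -> b <= c -> depth b <= depth c.
Proof.
move=> b0 bc; apply: le_depth => [|s sP]; first exact: le_trans bc.
by apply: depth_le => x xb; apply: sP; exact: le_trans bc.
Qed.

(** A very negative [s] makes the level small, and its dilated unit ball still
    contains a small ball. *)
Lemma depth_small e : 0 <= r -> 0 < e -> exists2 d, 0 < d & depth d <= e.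
Proof.
move=> r0 e0; have rn0 : 0 < r `^ nu + 1 by rewrite ltr_wpDl// powR_ge0.
pose s := ln (e / (r `^ nu + 1)) / nu.
have [d d0 dP] := dilated_ball_small hNk hGqm s.
exists d => //; apply: le_trans (depth_le dP) _.
rewrite powRM ?expR_ge0// -expRM /s divfK ?gt_eqF// lnK ?posrE ?divr_gt0//.
by rewrite mulrAC ler_pdivrMr// ler_wpM2l ?(ltW e0)// lerDl.
Qed.

End Gain.

(** * Input-to-state safety *)

Theorem theorem4p11 (R : realType) (n k p : nat)
    (Nn : 'cV[R]_n -> R) (Nk : 'cV[R]_k -> R)
    (hNn : is_norm Nn) (hNk : is_norm Nk)
    (G : 'M[R]_n) (Gq : 'M[R]_k)
    (hG : is_dilation Nn G) (hGm : monotone_dilation Nn G)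
    (hGq : is_dilation Nk Gq) (hGqm : monotone_dilation Nk Gq)
    (f : 'cV[R]_n -> 'cV[R]_k -> 'cV[R]_n)
    (hf : continuous (fun z : 'cV[R]_n * 'cV[R]_k => f z.1 z.2))
    (mu : R) (hmu : -1 < mu)
    (hfhom : forall s x q, f (dilation G s x) (dilation Gq s q) =
                           expR (mu * s) *: dilation G s (f x q))
    (phi : 'I_p -> 'cV[R]_n -> R) (nu : 'I_p -> R)
    (hphi : forall i, continuous (phi i))
    (hphi1 : forall i, C1_off_origin (phi i))
    (hnu : forall i, 0 < nu i)
    (hphihom : forall i, homogeneous G (nu i) (phi i))
    (hint : interior (safe_set phi) !=set0)
    (t0 : R)
    (hcomplete : forall q, Linfty q -> forward_complete f q t0)
    (hunique : forall q x0, Linfty q -> ~ interior (safe_set phi) x0 ->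
                 locally_forward_unique f q t0 x0)
    (htangent : exists2 r : 'I_p -> R, forall i, 0 <= r i &
       forall x q, boundary (enlarged_safe_set phi nu r) x -> Nk q <= 1 ->
         tangent_cone Nn (enlarged_safe_set phi nu r) x (f x q)) :
  ISSf f t0 phi.
Proof.
have [r r0 tang] := htangent.
pose gamma i := majorant (depth Nk Gq (r i) (nu i)).
exists gamma.
  move=> i; apply: majorant_class_K.
  - exact: depth_ge0.
  - exact: depth_homo.
  - by move=> e e0; exact: depth_small.
move=> x0 q x safe0 Lq solx t i t0t.
set c := Linfty_norm q t0 t.
have c0 : 0 <= c := Linfty_norm_ge0 q t0 t.
suff h s : dilated_ball Nk Gq s c -> - phi i (x t) <= (expR s * r i) `^ nu i.
  rewrite lerNl.
  apply: (@le_trans _ _ (depth Nk Gq (r i) (nu i) c)); first exact: le_depth.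
  apply: le_majorant => //.
  - exact: depth_ge0.
  - exact: depth_homo.
  - by move=> e e0; exact: depth_small.
move=> sc; rewrite -subr_ge0 opprK addrC.
suff : scaled_set phi nu r s (x t) by apply.
apply: (@forward_invariant _ _ _ f _ (safe_set phi) t0 c hf _ _ _ hunique q x0) => //.
- exact: scaled_set_closed.
- move=> y v Ky vc; have [w w1 <-] := sc v vc.
  exact: (scaled_set_bouligand hNn hGm hphihom r0 hfhom tang).
- by apply: interiorS => y; exact: safe_scaled_set.
- exact: safe_scaled_set.
- exact: Linfty_norm_ge.
Qed.
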